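(* Let $(\Omega,\mathcal{F},P)$ be a probability space and $d$ a positive integer. Let $\bar{B}_{1}(\mathbb{R}^{d})=\{y\in\mathbb{R}^{d}:|y|\leq1\}$ and $\partial\bar{B}_{1}(\mathbb{R}^{d})=\{y\in\mathbb{R}^{d}:|y|=1\}$ ($|\cdot|$ the Euclidean norm). The following assertions are equivalent: (A) $L^{0}(\mathcal{F},\partial\bar{B}_{1}(\mathbb{R}^{d}))$ is not a $\mathcal{T}_{c}$-$r$-image of $L^{0}(\mathcal{F},\bar{B}_{1}(\mathbb{R}^{d}))$; in particular, it is not a $\mathcal{T}_{c}$-retract of $L^{0}(\mathcal{F},\bar{B}_{1}(\mathbb{R}^{d}))$. (B) Every $\sigma$-stable $\mathcal{T}_{c}$-continuous mapping from $L^{0}(\mathcal{F},\bar{B}_{1}(\mathbb{R}^{d}))$ to itself has a fixed point. (C) For every nonempty, $\sigma$-stable, a.s. bounded, $\mathcal{T}_{c}$-closed and $L^0$-convex subset $G$ of $L^0(\mathcal{F},\mathbb{R}^d)$, every $\sigma$-stable $\mathcal{T}_{c}$-continuous mapping $f:G\to G$ has a fixed point.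
   Context: For a separable metric space $M$, $L^0(\mathcal{F},M)$ is the set of a.s.-equivalence classes of $M$-valued $\mathcal{F}$-measurable functions on $\Omega$; $L^0(\mathcal{F},\mathbb{R}^d)$ is a module over $L^0(\mathcal{F})=L^0(\mathcal{F},\mathbb{R})$ (with the a.s. order), with $L^0$-norm $\|x\|=\sqrt{\sum_{i=1}^dx_i^2}$. $L^0_+(\mathcal{F})=\{\xi\in L^0(\mathcal{F}):\xi\ge0\}$, $L^0_{++}(\mathcal{F})=\{\xi\in L^0(\mathcal{F}):\xi>0\text{ a.s.}\}$. $\mathcal{T}_c$ is the topology on $L^0(\mathcal{F},\mathbb{R}^d)$ with base the random open balls $B(x,r)=\{y:\|x-y\|<r\text{ a.s.}\}$, $r\in L^0_{++}(\mathcal{F})$. Note $L^0(\mathcal{F},\bar B_1(\mathbb{R}^d))=\{x\in L^0(\mathcal{F},\mathbb{R}^d):\|x\|\le1\}$ (the random closed unit ball). A subset $G$ of $L^0(\mathcal{F},\mathbb{R}^d)$ is a.s. bounded if $\bigvee\{\|x\|:x\in G\}\in L^0_+(\mathcal{F})$ (supremum in the lattice of classes of extended real random variables); $L^0$-convex if $\lambda x+(1-\lambda)y\in G$ for $x,y\in G$, $\lambda\in L^0_+(\mathcal{F})$, $\lambda\le1$; $\sigma$-stable if $\sum_n\tilde I_{A_n}x_n\in G$ for every sequence $\{x_n\}$ in $G$ and every countable measurable partition $\{A_n\}$ of $\Omega$ ($\tilde I_A$ is the class of the indicator of $A$). A mapping $f$ between $\sigma$-stable sets is $\sigma$-stable if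 $f(\sum_n\tilde I_{A_n}x_n)=\sum_n\tilde I_{A_n}f(x_n)$ for all such data; it is $\mathcal{T}_c$-continuous if continuous for $\mathcal{T}_c$ on domain and range. For $\sigma$-stable subsets $E,F$ of $L^0(\mathcal{F},\mathbb{R}^d)$, $E$ is a $\mathcal{T}_c$-$r$-image of $F$ if there exist $\mathcal{T}_c$-continuous $\sigma$-stable mappings $h:F\to E$ and $g:E\to F$ such that $h\circ g$ is the identity on $E$. If moreover $E\subseteq F$ and $g$ is the inclusion mapping, $E$ is called a $\mathcal{T}_c$-retract of $F$. *)

(* Defs.v *)
From HB Require Import structures.
From mathcomp Require Import all_boot all_order all_algebra.
From mathcomp Require Import all_classical all_reals all_analysis measurable_realfun.
From mathcomp Require Import ring.

Set Implicit Arguments.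
Unset Strict Implicit.
Unset Printing Implicit Defensive.

Import Order.TTheory GRing.Theory Num.Theory.
Import numFieldNormedType.Exports.

Local Open Scope classical_set_scope.
Local Open Scope ring_scope.
Local Open Scope quotient_scope.

Section Euclidean.
Context (R : realType) (n : nat).
Implicit Types u v : 'rV[R]_n.

(* [`|v|] on ['rV[R]_n] is the sup norm. *)
Definition enorm v : R := Num.sqrt (\sum_(i < n) v 0 i ^+ 2).

Lemma enorm_sqr v : enorm v ^+ 2 = \sum_(i < n) v 0 i ^+ 2.
Proof. by rewrite sqr_sqrtr// sumr_ge0// => i _; rewrite sqr_ge0. Qed.

Lemma enorm_ge0 v : 0 <= enorm v. Proof. exact: sqrtr_ge0. Qed.

Lemma enorm0 : enorm 0 = 0.
Proof. by rewrite /enorm big1 ?sqrtr0// => i _; rewrite mxE expr0n. Qed.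

Lemma enorm_eq0 v : enorm v = 0 -> v = 0.
Proof.
move=> v0; apply/rowP => i; rewrite mxE.
have /eqP : \sum_(i < n) v 0 i ^+ 2 = 0 by rewrite -enorm_sqr v0 expr0n.
rewrite psumr_eq0; last by move=> j _; rewrite sqr_ge0.
by move=> /allP/(_ i); rewrite mem_index_enum sqrf_eq0 => /(_ isT)/eqP.
Qed.

Lemma enorm_dot u v : \sum_(i < n) u 0 i * v 0 i <= enorm u * enorm v.
Proof.
have [/enorm_eq0 ->|u0] := eqVneq (enorm u) 0.
  by rewrite enorm0 mul0r big1// => i _; rewrite mxE mul0r.
have [/enorm_eq0 ->|v0] := eqVneq (enorm v) 0.
  by rewrite enorm0 mulr0 big1// => i _; rewrite mxE mulr0.
have up : 0 < enorm u by rewrite lt_def u0 enorm_ge0.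
have vp : 0 < enorm v by rewrite lt_def v0 enorm_ge0.
set a := enorm u in u0 up *; set b := enorm v in v0 vp *.
have -> : a * b = 2^-1 * (b / a * \sum_(i < n) u 0 i ^+ 2
                         + a / b * \sum_(i < n) v 0 i ^+ 2).
  by rewrite -!enorm_sqr -/a -/b; field; rewrite u0 v0.
rewrite !mulr_sumr -big_split/= mulr_sumr ler_sum// => i _.
rewrite -subr_ge0.
have -> : 2^-1 * (b / a * u 0 i ^+ 2 + a / b * v 0 i ^+ 2) - u 0 i * v 0 i
   = 2^-1 * (a * b)^-1 * (b * u 0 i - a * v 0 i) ^+ 2.
  by field; rewrite u0 v0.
by rewrite mulr_ge0 ?sqr_ge0// mulr_ge0 ?invr_ge0// mulr_ge0// ltW.
Qed.

Lemma enormD u v : enorm (u + v) <= enorm u + enorm v.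
Proof.
rewrite -(@ler_pXn2r _ 2)// ?nnegrE ?addr_ge0 ?enorm_ge0//.
rewrite enorm_sqr sqrrD !enorm_sqr.
have -> : \sum_(i < n) (u + v) 0 i ^+ 2 = \sum_(i < n) u 0 i ^+ 2
    + (\sum_(i < n) u 0 i * v 0 i) *+ 2 + \sum_(i < n) v 0 i ^+ 2.
  rewrite -sumrMnl -!big_split/=; apply: eq_bigr => i _.
  by rewrite mxE sqrrD.
by rewrite lerD2r lerD2l lerMn2r enorm_dot orbT.
Qed.

Definition borel_rV := g_sigma_algebraType (@open 'rV[R]_n).

Definition unit_ball : set 'rV[R]_n := [set v | enorm v <= 1].
Definition unit_sphere : set 'rV[R]_n := [set v | enorm v = 1].

End Euclidean.

Arguments unit_ball : clear implicits.
Arguments unit_sphere : clear implicits.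

Section MeasurableRow.
Context d (T : measurableType d) (R : realType) (n : nat).

Lemma open_bigcup_rat_rV (U : set 'rV[R]_n) : open U ->
  U = \bigcup_(k in [set k : 'rV[rat]_n * nat |
        ball (map_mx ratr k.1 : 'rV[R]_n) k.2.+1%:R^-1 `<=` U])
      ball (map_mx ratr k.1 : 'rV[R]_n) k.2.+1%:R^-1.
Proof.
move=> oU; apply/seteqP; split=> [x Ux|x [k kU]]; last exact: kU.
have /nbhs_ballP[e /= e0 xeU] : nbhs x U by apply: open_nbhs_nbhs; split.
have [m m_e] : exists m : nat, (m.+1%:R^-1 : R) < e / 2.
  have [m _ mh] := near_infty_natSinv_lt (PosNum (divr_gt0 e0 (ltr0n R 2))).
  by exists m; exact: (mh m (leqnn m)).
have m0 : (0 : R) < m.+1%:R^-1 by rewrite invr_gt0 ltr0n.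
have q_ex i : exists q : rat, `|ratr q - x 0 i| < m.+1%:R^-1.
  have [q] := @rat_in_itvoo R (x 0 i - m.+1%:R^-1) (x 0 i + m.+1%:R^-1)
    ltac:(rewrite ltrBlDr -addrA ltrDl addr_gt0//).
  by rewrite in_itv/= => qP; exists q; rewrite ltr_distl.
pose q : 'rV[rat]_n := \row_i sval (cid (q_ex i)).
have qx i : `|ratr (q 0 i) - x 0 i| < m.+1%:R^-1.
  by rewrite mxE; case: cid.
have bq : ball (map_mx ratr q : 'rV[R]_n) m.+1%:R^-1 x.
  by split=> // i j; rewrite ord1 mxE; exact: qx.
exists (q, m) => //= y yq; apply: xeU.
have : ball x (m.+1%:R^-1 + m.+1%:R^-1) y.
  by apply: ball_triangle yq; exact: ball_sym.
apply: le_ball; rewrite [e]splitr lerD// ltW//.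
Qed.

Lemma measurable_fun_rV (f : T -> borel_rV R n) :
  (forall i, measurable_fun setT (fun t => (f t : 'rV[R]_n) 0 i)) ->
  measurable_fun setT f.
Proof.
move=> mf; apply: (@measurability _ _ T (borel_rV R n) setT f (@open 'rV[R]_n) erefl).
move=> _ [U oU <-]; rewrite setTI (open_bigcup_rat_rV oU) preimage_bigcup.
rewrite bigcup_mkcond; apply: countable_bigcupT_measurable => // -[q m].
case: ifP => // _ /=.
have -> : f @^-1` ball (map_mx ratr q : 'rV[R]_n) m.+1%:R^-1 =
   \bigcap_(i in [set: 'I_n])
      ((fun t => (f t : 'rV[R]_n) 0 i) @^-1` ball (ratr (q 0 i) : R) m.+1%:R^-1).
  apply/seteqP; split=> t /= h.
    by move=> i _ /=; have := h.2 0 i; rewrite mxE.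
  split=> [|i j]; first by rewrite invr_gt0 ltr0n.
  by rewrite ord1 mxE; exact: (h j I).
apply: fin_bigcap_measurable => // i _.
by rewrite -[X in measurable X]setTI; apply: mf => //; exact: measurable_ball.
Qed.

Lemma measurable_coord (f : T -> borel_rV R n) i :
  measurable_fun setT f -> measurable_fun setT (fun t => (f t : 'rV[R]_n) 0 i).
Proof.
move=> mf; apply: (measurability _ (RGenOpens.measurableE R)).
move=> _ [_ [a [b ->]] <-].
apply: (mf measurableT ((fun v : 'rV[R]_n => v 0 i) @^-1` `]a, b[%classic)).
apply: sub_sigma_algebra.
apply: open_comp (interval_open _ _) => // v _; exact: coord_continuous.
Qed.

End MeasurableRow.

Lemma measurable_enorm d (T : measurableType d) (R : realType) (n : nat)
    (f : T -> borel_rV R n) :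
  measurable_fun setT f ->
  measurable_fun setT (fun t => enorm (f t : 'rV[R]_n)).
Proof.
move=> mf; apply: (measurableT_comp (continuous_measurable_fun _)).
  exact: sqrt_continuous.
apply: measurable_sum => i; apply: measurable_funX.
exact: measurable_coord.
Qed.

Section L0.
Context d (T : measurableType d) (R : realType) (P : probability T R).

Definition L0 : Type := {mfun_ P, T >-> R}.
HB.instance Definition _ := Choice.on L0.
HB.instance Definition _ := EqQuotient.on L0.

Definition L0_fun (x : L0) : T -> R := repr x.
Coercion L0_fun : L0 >-> Funclass.

Lemma L0_measurable (x : L0) : measurable_fun setT x.
Proof. exact: (measurable_funPT (repr x)). Qed.

Definition L0_class (f : T -> R) (mf : measurable_fun setT f) : L0 :=
  \pi_L0 (mfun_Sub (mem_set mf) : {mfun T >-> R}).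

Lemma L0_classE (f : T -> R) (mf : measurable_fun setT f) :
  {ae P, forall w, L0_class mf w = f w}.
Proof.
have /eqmodP/asboolP : repr (L0_class mf) = mfun_Sub (mem_set mf) %[mod L0].
  by rewrite reprK.
by apply: filterS => w; exact.
Qed.

Context (n : nat).

Definition L0V : Type := {mfun_ P, T >-> borel_rV R n}.
HB.instance Definition _ := Choice.on L0V.
HB.instance Definition _ := EqQuotient.on L0V.

Definition L0V_fun (x : L0V) : T -> 'rV[R]_n := repr x.
Coercion L0V_fun : L0V >-> Funclass.

Lemma L0V_measurable (x : L0V) :
  measurable_fun setT (x : T -> borel_rV R n).
Proof. exact: (measurable_funPT (repr x)). Qed.

Definition L0V_class (f : T -> borel_rV R n) (mf : measurable_fun setT f) :
  L0V := \pi_L0V (mfun_Sub (mem_set mf) : {mfun T >-> borel_rV R n}).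

Lemma L0V_classE (f : T -> borel_rV R n) (mf : measurable_fun setT f) :
  {ae P, forall w, L0V_class mf w = f w}.
Proof.
have /eqmodP/asboolP : repr (L0V_class mf) = mfun_Sub (mem_set mf) %[mod L0V].
  by rewrite reprK.
by apply: filterS => w; exact.
Qed.

(* Classes of [M]-valued measurable functions, as classes of row vectors. *)
Definition L0V_of (M : set 'rV[R]_n) : set L0V :=
  [set x | exists2 f : {mfun T >-> borel_rV R n},
     (forall w, M (f w)) & x = \pi_L0V f].

Lemma measurable_L0V_sub (x y : L0V) :
  measurable_fun setT (fun w => x w - y w : borel_rV R n).
Proof.
apply: measurable_fun_rV => i; under eq_fun do rewrite !mxE.
by apply: measurable_funB; apply: measurable_coord; exact: L0V_measurable.
Qed.

Lemma measurable_L0V_conv (l : L0) (x y : L0V) :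
  measurable_fun setT (fun w => l w *: x w + (1 - l w) *: y w : borel_rV R n).
Proof.
apply: measurable_fun_rV => i; under eq_fun do rewrite !mxE.
apply: measurable_funD; apply: measurable_funM.
- exact: L0_measurable.
- by apply: measurable_coord; exact: L0V_measurable.
- by apply: measurable_funB => //; exact: L0_measurable.
- by apply: measurable_coord; exact: L0V_measurable.
Qed.

Definition L0V_conv (l : L0) (x y : L0V) : L0V :=
  L0V_class (measurable_L0V_conv l x y).

(* Some of the blocks may be empty, so finite partitions are covered. *)
Record mpartition := MPartition {
  block :> nat -> set T;
  block_measurable : forall k, measurable (block k);
  block_trivIset : trivIset setT block;
  block_cover : \bigcup_k block k = setT
}.

(* Exactly one summand can be nonzero at each point, so the sum over the
   finite support is the sum of the series. *)
Definition glue_fun (A : mpartition) (x : nat -> L0V) (w : T) : 'rV[R]_n :=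
  \sum_(k \in [set: nat]) (\1_(A k) w *: x k w).

Lemma glue_funE (A : mpartition) (x : nat -> L0V) (k : nat) (w : T) :
  A k w -> glue_fun A x w = x k w.
Proof.
move=> Akw; rewrite /glue_fun -(@fsbig_widen _ _ _ _ [set k] setT)//.
  by rewrite fsbig_set1 indicE mem_set// scale1r.
move=> j [_ /= jk]; rewrite indicE memNset ?scale0r// => Ajw; apply: jk.
by apply: (@block_trivIset A) => //; exists w.
Qed.

Lemma measurable_glue (A : mpartition) (x : nat -> L0V) :
  measurable_fun setT (glue_fun A x : T -> borel_rV R n).
Proof.
rewrite -(block_cover A); apply/measurable_fun_bigcup => k.
  exact: block_measurable.
apply: (eq_measurable_fun (x k : T -> borel_rV R n)).
  by move=> w /set_mem Akw; rewrite (glue_funE x Akw).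
by apply: measurable_funTS; exact: L0V_measurable.
Qed.

Definition glue (A : mpartition) (x : nat -> L0V) : L0V :=
  L0V_class (measurable_glue A x).

Definition L0_ge0 : set L0 := [set r | {ae P, forall w, 0 <= r w}].
Definition L0_gt0 : set L0 := [set r | {ae P, forall w, 0 < r w}].

Definition rball (x : L0V) (r : L0) : set L0V :=
  [set y | {ae P, forall w, enorm (x w - y w) < r w}].

HB.instance Definition _ := isPointed.Build L0
  (L0_class (measurable_cst (0 : R))).
HB.instance Definition _ := isPointed.Build L0V
  (L0V_class (measurable_cst (0 : borel_rV R n))).

Lemma rball_cover :
  \bigcup_(i in [set i : L0V * L0 | L0_gt0 i.2]) rball i.1 i.2 = setT.
Proof.
apply/seteqP; split=> // x _.
exists (x, L0_class (measurable_cst (1 : R))).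
  by apply: filterS (L0_classE (measurable_cst (1 : R))) => w /= ->.
apply: filterS (L0_classE (measurable_cst (1 : R))) => w /= ->.
by rewrite subrr enorm0.
Qed.

Lemma rball_join (i j : L0V * L0) (t : L0V) :
  L0_gt0 i.2 -> L0_gt0 j.2 -> rball i.1 i.2 t -> rball j.1 j.2 t ->
  exists k : L0V * L0, [/\ L0_gt0 k.2, rball k.1 k.2 t &
    rball k.1 k.2 `<=` rball i.1 i.2 `&` rball j.1 j.2].
Proof.
move: i j => [x r] [y s] /= _ _ tx ty.
have mr : measurable_fun setT (fun w =>
    Num.min (r w - enorm (x w - t w)) (s w - enorm (y w - t w))).
  by apply: measurable_minr; apply: measurable_funB;
    do ?[exact: L0_measurable|exact/measurable_enorm/measurable_L0V_sub].
have t0 : L0_gt0 (L0_class mr).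
  apply: filterS3 tx ty (L0_classE mr) => w xw yw ->.
  by rewrite lt_min !subr_gt0 xw yw.
exists (t, L0_class mr); split => //=.
  by apply: filterS t0 => w; rewrite subrr enorm0.
move=> z /= tz; split.
  apply: filterS2 tz (L0_classE mr) => w + E; rewrite {}E lt_min => /andP[+ _].
  rewrite ltrBrDl; apply: le_lt_trans.
  by rewrite -[x w - z w](subrKA (t w)) enormD.
apply: filterS2 tz (L0_classE mr) => w + E; rewrite {}E lt_min => /andP[_].
rewrite ltrBrDl; apply: le_lt_trans.
by rewrite -[(y : L0V) w - z w](subrKA (t w)) enormD.
Qed.

HB.instance Definition _ :=
  isBaseTopological.Build L0V rball_cover rball_join.

Lemma nbhs_rballP (x : L0V) (U : set L0V) :
  nbhs x U <-> exists2 r, L0_gt0 r & rball x r `<=` U.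
Proof.
split.
  rewrite nbhsE => -[V [[D DD <-] [[y s] Dys /= yx]] VU].
  have mr : measurable_fun setT (fun w => (s : L0) w - enorm ((y : L0V) w - x w)).
    apply: measurable_funB; first exact: L0_measurable.
    exact/measurable_enorm/measurable_L0V_sub.
  exists (L0_class mr).
    by apply: filterS2 yx (L0_classE mr) => w h ->; rewrite subr_gt0.
  move=> z xz; apply: VU; exists (y, s) => //=.
  apply: filterS2 xz (L0_classE mr) => w + E; rewrite {}E ltrBrDl.
  by apply: le_lt_trans; rewrite -[(y : L0V) w - z w](subrKA (x w)) enormD.
move=> [r r0 rU]; rewrite nbhsE; exists (rball x r) => //; split.
  exists [set (x, r)]; first by move=> _ ->.
  by rewrite bigcup_set1.
by apply: filterS r0 => w; rewrite subrr enorm0.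
Qed.

Implicit Types E F G : set L0V.

(* The least upper bound is taken among classes of extended real valued random
   variables. *)
Definition as_bounded G := exists xi : L0, [/\ L0_ge0 xi,
  forall x, G x -> {ae P, forall w, enorm (x w) <= xi w} &
  forall eta : {mfun_ P, T >-> \bar R},
    (forall x, G x -> {ae P, forall w, ((enorm (x w))%:E <= eta w)%E}) ->
    {ae P, forall w, ((xi w)%:E <= eta w)%E}].

Definition L0_convex G := forall (x y : L0V) (l : L0), G x -> G y ->
  L0_ge0 l -> {ae P, forall w, l w <= 1} -> G (L0V_conv l x y).

Definition sigma_stable G := forall (A : mpartition) (x : nat -> L0V),
  (forall k, G (x k)) -> G (glue A x).

(* A mapping [E -> F] is represented by a total function sending [E] to [F],
   of which only the restriction to [E] matters. *)
Definition sigma_stable_map E (f : L0V -> L0V) :=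
  forall (A : mpartition) (x : nat -> L0V), (forall k, E (x k)) ->
    f (glue A x) = glue A (fun k => f (x k)).

Definition Tc_stable_map E F (f : L0V -> L0V) :=
  [/\ set_fun E F f, sigma_stable_map E f & {within E, continuous f}].

(* Only meant for [sigma_stable] sets [E] and [F]. *)
Definition Tc_r_image E F := exists h g : L0V -> L0V,
  [/\ Tc_stable_map F E h, Tc_stable_map E F g &
    forall x, E x -> h (g x) = x].

Definition Tc_retract E F := E `<=` F /\ exists h : L0V -> L0V,
  [/\ Tc_stable_map F E h, Tc_stable_map E F id & forall x, E x -> h x = x].

End L0.

Arguments L0V_of {d T R} P {n} M.

(* Main.v *)
(** No form of Brouwer's theorem is proved. Call a bounded uniformly continuous
    map from R^d to the unit sphere that fixes the sphere a classical
    retraction. Applied pointwise it yields a T_c-r-image, so (A) excludes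
    classical retractions. This deterministic consequence of (A) does not depend
    on the probability space and gives (C); arguing instead on the part of Omega
    where f has no local fixed point would only give a retraction over that part.

    Without classical retractions, every bounded uniformly continuous map of R^d
    into itself has approximate fixed points. Given f on G, take a sequence
    (e_j) in G that is a.s. pointwise dense (a Castaing representation),
    interpolate e_j(w) |-> f(e_j)(w) for j <= N by a partition of unity on R^d,
    and choose a measurable cluster point x of the rational approximate fixed
    points of these interpolations as N grows. Then x lies in G by convexity and
    closedness, and f(x) = x because sigma-stability makes the T_c-continuity of
    f at x local in w.

    Finally (C) contains (B), and (B) gives (A) because a fixed point of
    x |-> g(-h(x)) satisfies h(x) = -h(x). *)
Require Import Defs.
From mathcomp Require Import all_boot all_order all_algebra.
From mathcomp Require Import all_classical all_reals all_analysis.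
From mathcomp Require Import measurable_realfun ring lra.

Set Implicit Arguments.
Unset Strict Implicit.
Unset Printing Implicit Defensive.

Import Order.TTheory GRing.Theory Num.Theory.
Import numFieldNormedType.Exports.

Local Open Scope classical_set_scope.
Local Open Scope ring_scope.
Local Open Scope quotient_scope.

(** * Bounded uniformly continuous functions on R^n *)

Section EuclideanNorm.
Context (R : realType) (n : nat).
Implicit Types u v w : 'rV[R]_n.

Lemma enormZ (a : R) v : enorm (a *: v) = `|a| * enorm v.
Proof.
rewrite /enorm -sqrtr_sqr -sqrtrM ?sqr_ge0// mulr_sumr; congr Num.sqrt.
by apply: eq_bigr => i _; rewrite mxE exprMn.
Qed.

Lemma enormN v : enorm (- v) = enorm v.
Proof. by rewrite -scaleN1r enormZ normrN1 mul1r. Qed.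

Lemma enorm_distC u v : enorm (u - v) = enorm (v - u).
Proof. by rewrite -enormN opprB. Qed.

Lemma ler_enorm_dist u v : `|enorm u - enorm v| <= enorm (u - v).
Proof.
rewrite ler_norml; apply/andP; split.
  rewrite lerBrDr addrC lerBlDr addrC enorm_distC.
  by rewrite -[X in enorm X <= _](subrK u) enormD.
by rewrite lerBlDr -[X in enorm X <= _](subrK v) enormD.
Qed.

Lemma enorm_triangle u v w : enorm (u - w) <= enorm (u - v) + enorm (v - w).
Proof. by rewrite -[u - w](subrKA v) enormD. Qed.

Lemma ler_coord_enorm v i : `|v 0 i| <= enorm v.
Proof.
rewrite -sqrtr_sqr ler_wsqrtr// (bigD1 i)//= lerDl sumr_ge0// => j _.
exact: sqr_ge0.
Qed.

Lemma enorm_sum I (r : seq I) (Q : pred I) (F : I -> 'rV[R]_n) :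
  enorm (\sum_(i <- r | Q i) F i) <= \sum_(i <- r | Q i) enorm (F i).
Proof.
elim/big_ind2 : _ => [|x a y b xa yb|//]; first by rewrite enorm0.
by rewrite (le_trans (enormD _ _))// lerD.
Qed.

Lemma enorm_le_l1 v : enorm v <= \sum_(i < n) `|v 0 i|.
Proof.
have s0 : 0 <= \sum_(i < n) `|v 0 i| by rewrite sumr_ge0.
rewrite -(@ler_pXn2r _ 2)// ?nnegrE ?enorm_ge0// enorm_sqr expr2 mulr_suml.
apply: ler_sum => i _; rewrite -real_normK ?num_real// expr2 ler_wpM2l//.
by rewrite (bigD1 i)//= lerDl sumr_ge0.
Qed.

(** Dividing by [n.+1] instead of [n] makes the sum of the coordinates strictly smaller than [e] and
    covers dimension 0. *)
Lemma enorm_lt_coord v e : 0 < e -> (forall i, `|v 0 i| <= e / n.+1%:R) ->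
  enorm v < e.
Proof.
move=> e0 ve; apply: le_lt_trans (enorm_le_l1 _) _.
apply: (@le_lt_trans _ _ (\sum_(i < n) e / n.+1%:R)); first exact: ler_sum.
rewrite sumr_const card_ord -[X in X < _]mulr_natr -mulrA gtr_pMr//.
by rewrite mulrC ltr_pdivrMr// mul1r ltr_nat.
Qed.

End EuclideanNorm.

Section BoundedUniformlyContinuous.
Context (R : realType) (n : nat).
Implicit Types h k : 'rV[R]_n -> R.

(** Boundedness makes the class closed under products. Uniform continuity gives moduli that do not
    depend on the point, hence not on [w] once the map is applied to random vectors. *)
Definition buc h := (exists M, forall x, `|h x| <= M) /\
  (forall e, 0 < e -> exists2 r, 0 < r &
     forall x y, enorm (x - y) < r -> `|h x - h y| < e).

Lemma buc_bound h : buc h -> exists2 M, 0 < M & forall x, `|h x| <= M.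
Proof.
move=> [[M hM] _]; exists (`|M| + 1); first by rewrite ltr_wpDl.
by move=> x; rewrite (le_trans (hM x))// (le_trans (ler_norm _))// lerDl.
Qed.

Lemma buc_lipschitz h (M C : R) : 0 < C -> (forall x, `|h x| <= M) ->
  (forall x y, `|h x - h y| <= C * enorm (x - y)) -> buc h.
Proof.
move=> C0 hM hC; split; first by exists M.
move=> e e0; exists (e / C); first exact: divr_gt0.
by move=> x y xy; rewrite (le_lt_trans (hC _ _))// mulrC -ltr_pdivlMr.
Qed.

Lemma buc_cst (c : R) : buc (fun=> c).
Proof.
apply: (@buc_lipschitz _ `|c| 1) => // x y.
by rewrite subrr normr0 mul1r enorm_ge0.
Qed.

Lemma bucD h k : buc h -> buc k -> buc (fun x => h x + k x).
Proof.
move=> [[M hM] hu] [[N kN] ku]; split.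
  by exists (M + N) => x; rewrite (le_trans (ler_normD _ _))// lerD.
move=> e e0; have e2 : 0 < e / 2 by rewrite divr_gt0.
have [r r0 hr] := hu _ e2; have [s s0 ks] := ku _ e2.
exists (Num.min r s); first by rewrite lt_min r0.
move=> x y; rewrite lt_min => /andP[xr xs].
rewrite opprD addrACA (le_lt_trans (ler_normD _ _))// [e]splitr.
by rewrite ltrD ?hr ?ks.
Qed.

Lemma bucM h k : buc h -> buc k -> buc (fun x => h x * k x).
Proof.
move=> bh bk; have [M M0 hM] := buc_bound bh; have [N N0 kN] := buc_bound bk.
case: bh bk => _ hu [_ ku]; split.
  by exists (M * N) => x; rewrite normrM ler_pM.
move=> e e0.
have [r r0 hr] := hu (e / 2 / N) ltac:(by rewrite !divr_gt0).
have [s s0 ks] := ku (e / 2 / M) ltac:(by rewrite !divr_gt0).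
exists (Num.min r s); first by rewrite lt_min r0.
move=> x y; rewrite lt_min => /andP[/hr xr /ks xs].
have -> : h x * k x - h y * k y = (h x - h y) * k x + h y * (k x - k y) by ring.
rewrite (le_lt_trans (ler_normD _ _))// [e]splitr !normrM ltrD//.
  rewrite ltr_pdivlMr// in xr; apply: le_lt_trans xr.
  by rewrite ler_wpM2l.
rewrite ltr_pdivlMr// mulrC in xs; apply: le_lt_trans xs.
by rewrite ler_wpM2r.
Qed.

Lemma bucN h : buc h -> buc (fun x => - h x).
Proof.
move=> bh; have := bucM (buc_cst (-1)) bh.
by under eq_fun do rewrite mulN1r.
Qed.

Lemma buc_sum (I : Type) (r : seq I) (F : I -> 'rV[R]_n -> R) :
  (forall i, buc (F i)) -> buc (fun x => \sum_(i <- r) F i x).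
Proof.
move=> bF; elim: r => [|i r IH].
  under eq_fun do rewrite big_nil; exact: buc_cst.
by under eq_fun do rewrite big_cons; exact: bucD.
Qed.

Lemma bucV h (c : R) : 0 < c -> (forall x, c <= h x) -> buc h ->
  buc (fun x => (h x)^-1).
Proof.
move=> c0 ch [_ hu].
have h0 x : 0 < h x by rewrite (lt_le_trans c0).
split.
  exists c^-1 => x.
  by rewrite ger0_norm ?invr_ge0 ?(ltW (h0 x))// lef_pV2 ?posrE.
move=> e e0; have [r r0 hr] := hu (e * c * c) ltac:(by rewrite !mulr_gt0).
exists r => // x y /hr xy.
have -> : (h x)^-1 - (h y)^-1 = (h y - h x) / (h x * h y).
  by field; rewrite !gt_eqF.
rewrite normrM distrC normfV ltr_pdivrMr ?normr_gt0 ?mulf_neq0 ?gt_eqF//.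
rewrite (lt_le_trans xy)// -mulrA ler_wpM2l ?(ltW e0)// ger0_norm.
  by rewrite ler_pM// ltW.
by rewrite mulr_ge0// ltW.
Qed.

Lemma buc_sqrt h : (forall x, 0 <= h x) -> buc h ->
  buc (fun x => Num.sqrt (h x)).
Proof.
move=> h0 bh; have [M M0 hM] := buc_bound bh; split.
  exists (Num.sqrt M) => x; rewrite ger0_norm ?sqrtr_ge0//.
  by rewrite ler_wsqrtr// (le_trans (ler_norm _)).
move=> e e0; case: bh => _ /(_ (e ^+ 2) (exprn_gt0 _ e0))[r r0 hr].
(* The square root is not Lipschitz at 0, but [h y + e ^+ 2 <= (Num.sqrt (h y) + e) ^+ 2], so a
   modulus of [h] at precision [e ^+ 2] serves at precision [e]. *)
have key x y : h x - h y < e ^+ 2 -> Num.sqrt (h x) < Num.sqrt (h y) + e.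
  move=> xy; have p : 0 < Num.sqrt (h y) + e by rewrite ltr_wpDl ?sqrtr_ge0.
  rewrite -(@ltr_pXn2r _ 2)// ?nnegrE ?sqrtr_ge0 ?ltW// sqr_sqrtr//.
  have := sqrtr_ge0 (h y); have := sqr_sqrtr (h0 y); nra.
exists r => // x y /hr; rewrite ltr_norml => /andP[yx xy].
have := key _ _ xy; have := key y x ltac:(by rewrite ltrNl opprB in yx).
by rewrite ltr_norml => ? ?; apply/andP; split; lra.
Qed.

Lemma buc_comp h (K : R) (f : 'rV[R]_n -> 'rV[R]_n) : 0 < K ->
  (forall x y, enorm (f x - f y) <= K * enorm (x - y)) -> buc h ->
  buc (h \o f).
Proof.
move=> K0 fK [[M hM] hu]; split; first by exists M => x /=.
move=> e /hu[r r0 hr]; exists (r / K); first exact: divr_gt0.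
move=> x y xy; apply: hr; apply: le_lt_trans (fK _ _) _.
by rewrite mulrC -ltr_pdivlMr.
Qed.

End BoundedUniformlyContinuous.

(** * Approximate fixed points from the absence of retractions *)

Section ApproximateFixedPoints.
Context (R : realType) (n : nat).
Implicit Types (x y : 'rV[R]_n) (g r : 'rV[R]_n -> 'rV[R]_n).

Definition buc_map g := forall i, buc (fun x => g x 0 i).

Definition sphere_retraction r :=
  [/\ buc_map r, forall x, enorm (r x) = 1 & forall x, enorm x = 1 -> r x = x].

(** This is the nearest-point projection onto the closed unit ball. *)
Definition radial x : 'rV[R]_n := (Num.max 1 (enorm x))^-1 *: x.

Lemma radial_le1 x : enorm (radial x) <= 1.
Proof.
have m0 : 0 < Num.max 1 (enorm x) by rewrite lt_max ltr01.
rewrite enormZ ger0_norm ?invr_ge0 ?(ltW m0)// mulrC ler_pdivrMr// mul1r.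
by rewrite le_max lexx orbT.
Qed.

Lemma radial_id x : enorm x <= 1 -> radial x = x.
Proof. by move=> x1; rewrite /radial max_l// invr1 scale1r. Qed.

(** The difference splits into a change of vector at the fixed scale [M^-1] and a change of scale
    applied to [y]. Each part is at most [enorm (x - y)], since [1 <= M] and [enorm y <= N]; hence
    the constant 2. *)
Lemma radial_lipschitz x y : enorm (radial x - radial y) <= 2 * enorm (x - y).
Proof.
rewrite /radial; set M := Num.max 1 (enorm x); set N := Num.max 1 (enorm y).
have M1 : 1 <= M by rewrite le_max lexx.
have N1 : 1 <= N by rewrite le_max lexx.
have yN : enorm y <= N by rewrite le_max lexx orbT.
have M0 : 0 < M by rewrite (lt_le_trans ltr01).
have N0 : 0 < N by rewrite (lt_le_trans ltr01).
have MN : `|N - M| <= enorm (x - y).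
  rewrite distrC; have := ler_enorm_dist x y.
  rewrite /M /N !ler_norml => /andP[? ?].
  by case: (leP 1 (enorm x)) => ?; case: (leP 1 (enorm y)) => ?;
    apply/andP; split; lra.
have -> : M^-1 *: x - N^-1 *: y = M^-1 *: (x - y) + ((N - M) / (M * N)) *: y.
  have -> : (N - M) / (M * N) = M^-1 - N^-1 by field; rewrite !gt_eqF.
  by rewrite scalerBr scalerBl addrA subrK.
rewrite (le_trans (enormD _ _))// mulr_natl mulr2n lerD//.
  rewrite enormZ ger0_norm ?invr_ge0 ?(ltW M0)// ler_piMl ?enorm_ge0//.
  by rewrite invf_le1.
rewrite enormZ normrM (ger0_norm (_ : 0 <= (M * N)^-1)); last first.
  by rewrite invr_ge0 mulr_ge0// ltW.
apply: le_trans MN; rewrite -mulrA ler_piMr// invfM -mulrA.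
rewrite mulr_ile1 ?invr_ge0 ?(ltW M0) ?invf_le1//.
  by rewrite mulr_ge0 ?invr_ge0 ?enorm_ge0// ltW.
by rewrite mulrC ler_pdivrMr// mul1r.
Qed.

Lemma buc_radial : buc_map radial.
Proof.
move=> i; apply: (@buc_lipschitz _ _ _ 1 2) => // [x|x y].
  exact: le_trans (ler_coord_enorm _ _) (radial_le1 x).
have := ler_coord_enorm (radial x - radial y) i; rewrite !mxE => /le_trans; apply.
exact: radial_lipschitz.
Qed.

Let dot x y := \sum_(i < n) x 0 i * y 0 i.

Let dotxx x : dot x x = enorm x ^+ 2.
Proof. by rewrite enorm_sqr; apply: eq_bigr => i _; rewrite expr2. Qed.

(* The retraction sends [x] to the point where the ray from [g x] through [x]
   leaves the ball; precomposing with [radial] makes it total. *)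
Lemma approx_fixed_point_unit g : ~ (exists r, sphere_retraction r) ->
  buc_map g -> (forall x, enorm (g x) <= 1) ->
  forall e, 0 < e -> exists x, enorm (g x - x) < e.
Proof.
move=> nr bg g1 e e0; apply: contra_notP nr => /forallNP nfix.
have far x : e <= enorm (g x - x) by rewrite leNgt; apply/negP/nfix.
pose a x := radial x - g (radial x).
pose A x := dot (a x) (a x); pose b x := dot (radial x) (a x).
pose c x := 1 - dot (radial x) (radial x).
have A_ge x : e ^+ 2 <= A x.
  by rewrite /A dotxx ler_pXn2r ?nnegrE ?enorm_ge0 ?(ltW e0)// /a enorm_distC.
have e20 : 0 < e ^+ 2 by rewrite exprn_gt0.
have A_gt0 x : 0 < A x by exact: lt_le_trans (A_ge x).
have c_ge0 x : 0 <= c x.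
  by rewrite subr_ge0 dotxx expr_le1 ?enorm_ge0 ?radial_le1.
pose D x := b x ^+ 2 + A x * c x.
have D_ge0 x : 0 <= D x by rewrite addr_ge0 ?sqr_ge0// mulr_ge0// ltW.
(* [t x] is the larger root of [A t^2 + 2 b t - c = 0], which says that [radial x + t a] has norm 1.
   The lower bound [e ^+ 2 <= A x] keeps the quotient bounded and uniformly continuous. *)
pose t x := (Num.sqrt (D x) - b x) / A x.
have ba : buc_map a.
  move=> i; rewrite /a; under eq_fun do rewrite mxE [X in _ + X]mxE.
  apply: bucD; first exact: buc_radial.
  apply: bucN; apply: (@buc_comp _ _ (fun x => g x 0 i) 2 radial) => //.
  exact: radial_lipschitz.
have bdot f k : buc_map f -> buc_map k -> buc (fun x => dot (f x) (k x)).
  by move=> bf bk; apply: buc_sum => i; apply: bucM.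
have bA : buc A by exact: bdot.
have bb : buc b by apply: bdot => //; exact: buc_radial.
have bc : buc c.
  apply: bucD; first exact: buc_cst.
  by apply: bucN; apply: bdot; exact: buc_radial.
have bt : buc t.
  apply: bucM; last exact: (bucV e20 A_ge bA).
  apply: bucD; last exact: bucN.
  apply: buc_sqrt => //; apply: bucD; last exact: bucM.
  by under eq_fun do rewrite expr2; exact: bucM.
exists (fun x => radial x + t x *: a x); split.
- move=> i; under eq_fun do rewrite mxE [X in _ + X]mxE.
  by apply: bucD; [exact: buc_radial|apply: bucM].
- move=> x; apply/eqP; rewrite -(@eqrXn2 _ 2)// ?enorm_ge0// expr1n -dotxx.
  have -> : dot (radial x + t x *: a x) (radial x + t x *: a x) =
      dot (radial x) (radial x) + 2 * t x * b x + t x ^+ 2 * A x.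
    rewrite /b /A /dot !mulr_sumr -!big_split/=; apply: eq_bigr => i _.
    by rewrite !mxE; ring.
  have -> : dot (radial x) (radial x) = 1 - c x by rewrite /c subKr.
  have sD := sqr_sqrtr (D_ge0 x); apply/eqP.
  have -> : 1 - c x + 2 * t x * b x + t x ^+ 2 * A x =
      1 + (Num.sqrt (D x) ^+ 2 - D x) / A x.
    by rewrite /t /D; field; rewrite gt_eqF.
  by rewrite sD subrr mul0r addr0.
- move=> x x1; have rx : radial x = x by rewrite radial_id// x1.
  (* On the sphere [c x = 0], so the square root is the absolute value of [b x]. Cauchy-Schwarz and
     [enorm (g x) <= 1] give [0 <= b x], whence [t x = 0]. *)
  have b0 : 0 <= b x.
    rewrite /b /a rx; have -> : dot x (x - g x) = 1 - dot x (g x).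
      transitivity (dot x x - dot x (g x)); last by rewrite dotxx x1 expr1n.
      by rewrite /dot -sumrB; apply: eq_bigr => i _; rewrite !mxE mulrBr.
    by rewrite subr_ge0 (le_trans (enorm_dot _ _))// x1 mul1r.
  have c0 : c x = 0 by rewrite /c rx dotxx x1 expr1n subrr.
  rewrite /t /D c0 mulr0 addr0 sqrtr_sqr ger0_norm// subrr mul0r scale0r addr0.
  exact: rx.
Qed.

(** Conjugating with the dilation by [M] reduces to the unit ball and turns the precision [e] into
    [e / M]. *)
Lemma approx_fixed_point g (M : R) : ~ (exists r, sphere_retraction r) ->
  0 < M -> buc_map g -> (forall x, enorm (g x) <= M) ->
  forall e, 0 < e -> exists x, enorm (g x - x) < e.
Proof.
move=> nr M0 bg gM e e0.
have [|x|y hy] := @approx_fixed_point_unit (fun y => M^-1 *: g (M *: y)) nr _ _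
    (e / M) ltac:(exact: divr_gt0).
- move=> i; under eq_fun do rewrite !mxE.
  apply: bucM; first exact: buc_cst.
  apply: (@buc_comp _ _ (fun x => g x 0 i) M (fun y => M *: y)) => //= x y.
  by rewrite -scalerBr enormZ gtr0_norm.
- by rewrite enormZ gtr0_norm ?invr_gt0// mulrC ler_pdivrMr// mul1r.
exists (M *: y); rewrite ltr_pdivlMr// in hy.
rewrite -[g _ - _]scale1r -(divff (lt0r_neq0 M0)) -scalerA enormZ.
rewrite gtr0_norm// mulrC.
by rewrite scalerBr scalerA mulVf ?gt_eqF// scale1r.
Qed.

End ApproximateFixedPoints.

(** * Interpolation of scattered data *)

Section Interpolation.
Context (R : realType) (n : nat).
Implicit Types (x y : 'rV[R]_n) (e g : nat -> 'rV[R]_n) (N j : nat).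

Fixpoint mindist e N y : R :=
  if N is M.+1 then Num.min (mindist e M y) (enorm (y - e N))
  else enorm (y - e 0%N).

Lemma mindist_le e N j y : (j <= N)%N -> mindist e N y <= enorm (y - e j).
Proof.
elim: N => [|N IH]; first by rewrite leqn0 => /eqP ->.
rewrite leq_eqVlt => /predU1P[->|/IH h]; rewrite /= ge_min ?lexx ?orbT//.
by rewrite h.
Qed.

Lemma mindist_attained e N y :
  exists2 j, (j <= N)%N & mindist e N y = enorm (y - e j).
Proof.
elim: N => [|N [j jN jE]]; first by exists 0%N.
rewrite /= minEle; case: ifPn => _; last by exists N.+1.
by exists j => //; rewrite leqW.
Qed.

Lemma mindist_lipschitz e N x y :
  `|mindist e N x - mindist e N y| <= enorm (x - y).
Proof.
have le u v : mindist e N u - mindist e N v <= enorm (u - v).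
  have [j jN ->] := mindist_attained e N v.
  rewrite lerBlDr (le_trans (mindist_le _ _ jN))//.
  exact: enorm_triangle.
by rewrite ler_norml lerNl opprB le andbT enorm_distC.
Qed.

(** A tent that vanishes unless [e j] is within [N.+1%:R^-1] of being a nearest node to [y]. A
    nearest node has weight exactly [N.+1%:R^-1], which bounds the total weight away from 0. *)
Definition weight e N j y : R :=
  Num.max 0 (mindist e N y + N.+1%:R^-1 - enorm (y - e j)).

Lemma weight_ge0 e N j y : 0 <= weight e N j y.
Proof. by rewrite le_max lexx. Qed.

Lemma weight_le e N j y : (j <= N)%N -> weight e N j y <= N.+1%:R^-1.
Proof.
move=> jN; rewrite ge_max invr_ge0 ler0n/=.
by move: (mindist_le e y jN) (N.+1%:R^-1) => ? ?; lra.
Qed.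

Lemma buc_weight e N j : (j <= N)%N -> buc (weight e N j).
Proof.
move=> jN; apply: (@buc_lipschitz _ _ _ N.+1%:R^-1 2) => // [y|x y].
  by rewrite ger0_norm ?weight_ge0// weight_le.
have := mindist_lipschitz e N x y; have := ler_enorm_dist (x - e j) (y - e j).
rewrite opprB addrA subrK /weight !ler_norml => /andP[? ?] /andP[? ?].
set a := mindist e N x + _ - _; set b := mindist e N y + _ - _.
have ab : - (2 * enorm (x - y)) <= a - b <= 2 * enorm (x - y).
  by rewrite /a /b; move: (N.+1%:R^-1) => ?; apply/andP; split; lra.
have := enorm_ge0 (x - y); case/andP: ab.
by case: (leP 0 a) => ?; case: (leP 0 b) => ? *; apply/andP; split; lra.
Qed.

Definition total_weight e N y : R := \sum_(j < N.+1) weight e N j y.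

Lemma total_weight_ge e N y : N.+1%:R^-1 <= total_weight e N y.
Proof.
have [j jN jE] := mindist_attained e N y.
rewrite /total_weight (bigD1 (Ordinal (jN : (j < N.+1)%N)))//= /weight jE.
rewrite addrAC subrr add0r.
rewrite ler_wpDr ?sumr_ge0// => [i _|]; first by rewrite le_max lexx.
by rewrite le_max lexx orbT.
Qed.

Lemma total_weight_gt0 e N y : 0 < total_weight e N y.
Proof. by rewrite (lt_le_trans _ (total_weight_ge _ _ _))// invr_gt0. Qed.

Definition interpolate e g N y : 'rV[R]_n :=
  (total_weight e N y)^-1 *: \sum_(j < N.+1) weight e N j y *: g j.

Lemma buc_interpolate e g N : buc_map (interpolate e g N).
Proof.
move=> i; rewrite /interpolate; under eq_fun do rewrite mxE.
apply: bucM.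
  apply: bucV (total_weight_ge e N) _; first by rewrite invr_gt0.
  by apply: buc_sum => j; apply: buc_weight; rewrite -ltnS.
under eq_fun do rewrite summxE.
apply: buc_sum => j; under eq_fun do rewrite mxE.
apply: bucM; last exact: buc_cst.
by apply: buc_weight; rewrite -ltnS.
Qed.

(** The interpolation is a convex combination of the [g j] of positive weight, so only nodes almost
    nearest to [y] need checking. With [a = 0] this bounds the interpolation; with another [a] it
    localises it. *)
Lemma interpolate_dist e g N y (a : 'rV[R]_n) (r : R) :
  (forall j, (j <= N)%N -> enorm (y - e j) < mindist e N y + N.+1%:R^-1 ->
     enorm (g j - a) <= r) ->
  enorm (interpolate e g N y - a) <= r.
Proof.
move=> near; have W0 := total_weight_gt0 e N y.
have -> : interpolate e g N y - a = (total_weight e N y)^-1 *: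
    \sum_(j < N.+1) weight e N j y *: (g j - a).
  under eq_bigr do rewrite scalerBr.
  rewrite sumrB scalerBr -scaler_suml scalerA mulVf ?gt_eqF//.
  by rewrite scale1r.
rewrite enormZ gtr0_norm ?invr_gt0// mulrC ler_pdivrMr//.
rewrite (le_trans (enorm_sum _ _ _))// /total_weight mulr_sumr ler_sum// => j _.
rewrite enormZ ger0_norm ?weight_ge0// mulrC.
have [|yj] := ltP (enorm (y - e j)) (mindist e N y + N.+1%:R^-1).
  by move=> /near h; rewrite ler_wpM2r ?weight_ge0// h// -ltnS.
by rewrite /weight max_l ?subr_le0// !mulr0.
Qed.

End Interpolation.

(** * Measurable cluster points *)

Section PenalizedLimit.
Context (R : realType).
Implicit Types u v : nat -> R.

(** The supremum over [k] of the infimum over [m] of [u m + k * v m]: started at index 0, [esups]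
    and [einfs] range over the whole sequence. Extended reals make measurability independent of
    boundedness. *)
Definition penalized_limit u v : R :=
  fine (esups (fun k => einfs (fun m => (u m + k%:R * v m)%:E) 0%N) 0%N).

(* The penalty [k v] forces near-minimisers of [u + k v] onto indices where [v]
   is small, so this selects a limit point of [u] along [v -> 0] by an explicit,
   hence measurable, formula. *)
Lemma penalized_limitP u v (M : R) :
  (forall m, `|u m| <= M + v m) -> (forall m, 0 <= v m) ->
  (forall e, 0 < e -> exists m, v m < e) ->
  forall e, 0 < e -> exists m, v m + `|u m - penalized_limit u v| < e.
Proof.
move=> uM v0 vlim e e0.
rewrite /penalized_limit.
set s := fun k : nat => einfs _ 0%N; set S := esups s 0%N.
have s_le k m : (s k <= (u m + k%:R * v m)%:E)%E.
  by apply: ereal_inf_lbound; exists m.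
have s_S k : (s k <= S)%E by apply: ereal_sup_ubound; exists k.
have S_le : (S <= M%:E)%E.
  apply: ge_ereal_sup => _ [k _ <-]; apply/lee_addgt0Pr => r r0.
  have [m vm] := vlim (r / k.+1%:R) ltac:(by rewrite divr_gt0).
  apply: le_trans (s_le k m) _; rewrite -EFinD lee_fin.
  move: vm; rewrite ltr_pdivlMr// -natr1 => vm.
  by have := le_trans (ler_norm _) (uM m); lra.
(* The penalty with [k = 1] already compensates the [v m] in the lower bound [- M - v m <= u m]. *)
have S_ge : ((- M)%:E <= S)%E.
  apply: le_trans (s_S 1%N); apply: le_ereal_inf_tmp => _ [m _ <-].
  by rewrite lee_fin; have := uM m; rewrite ler_norml => /andP[]; lra.
have [X SX] : exists X, S = X%:E.
  by move: S_le S_ge; case: (S) => [X|//|//]; exists X.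
rewrite SX/=; pose h := e / 6.
have h0 : 0 < h by rewrite divr_gt0.
have : ((X - h)%:E < S)%E by rewrite SX lte_fin gtrBl.
move=> /ereal_sup_gt[_ [k _ <-] sk].
(* Comparing [u m + (2 * k + 1) * v m < X + h] with [X - h < u m + k * v m] gives
   [(k + 1) * v m < 2 * h]. Hence [v m < 2 * h] and [u m] is within [3 * h] of [X], and
   [5 * h < e]. *)
have : (s (2 * k + 1)%N < (X + h)%:E)%E.
  by apply: le_lt_trans (s_S _) _; rewrite SX lte_fin ltrDl.
move=> /ereal_inf_lt[_ [m _ <-]].
rewrite lte_fin natrD natrM => um.
have := lt_le_trans sk (s_le k m); rewrite lte_fin => lm.
have kv : 0 <= k%:R * v m by rewrite mulr_ge0.
exists m; have vm := v0 m.
have : `|u m - X| < 3 * h by rewrite ltr_norml; apply/andP; split; lra.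
by rewrite /h in h0 um lm *; lra.
Qed.

Context d (T : measurableType d).

Lemma measurable_penalized_limit (u v : nat -> T -> R) :
  (forall m, measurable_fun setT (u m)) ->
  (forall m, measurable_fun setT (v m)) ->
  measurable_fun setT (fun w => penalized_limit (u ^~ w) (v ^~ w)).
Proof.
move=> mu mv; apply: (measurableT_comp (fine_measurable measurableT)).
apply: (measurable_fun_esups (f := fun k w =>
  einfs (fun m => (u m w + k%:R * v m w)%:E) 0%N)) => k.
apply: (measurable_fun_einfs (f := fun m w => (u m w + k%:R * v m w)%:E)) => m.
apply/measurable_EFinP/measurable_funD => //.
by apply: measurable_funM.
Qed.

(* Limits in the successive coordinates, each one added to the penalty for the
   next. *)
Lemma measurable_cluster_point n (p : nat -> T -> 'rV[R]_n)
    (v : nat -> T -> R) :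
  (forall m i, measurable_fun setT (fun w => p m w 0 i)) ->
  (forall m, measurable_fun setT (v m)) ->
  exists2 x : T -> 'rV[R]_n, forall i, measurable_fun setT (fun w => x w 0 i) &
  forall w, (forall m, 0 <= v m w) ->
    (forall e, 0 < e -> exists m, v m w < e) ->
    (exists M, forall m, enorm (p m w) <= M + v m w) ->
    forall e, 0 < e -> exists m, v m w + enorm (p m w - x w) < e.
Proof.
(* Coordinates are indexed by [nat], with value 0 from [n] on, so that the induction can run over
   the number [k] of coordinates already treated. *)
move=> mp mv; pose u i m w := if insub i is Some j then p m w 0 j else 0.
have mu i m : measurable_fun setT (u i m).
  by rewrite /u; case: insubP => [j _ _|_]; [exact: mp|exact: measurable_cst].
have u_le i m w : `|u i m w| <= enorm (p m w).
  rewrite /u; case: insubP => [j _ _|_]; first exact: ler_coord_enorm.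
  by rewrite normr0 enorm_ge0.
have /(_ n)[x mx xP] k : exists2 x : nat -> T -> R,
    forall i, measurable_fun setT (x i) &
  forall w, (forall m, 0 <= v m w) ->
    (forall e, 0 < e -> exists m, v m w < e) ->
    (exists M, forall m, enorm (p m w) <= M + v m w) ->
    forall e, 0 < e -> exists m, v m w + \sum_(i < k) `|u i m w - x i w| < e.
  elim: k => [|k [x mx xP]].
    exists (fun _ _ => 0) => // w _ vlim _ e e0.
    by have [m vm] := vlim _ e0; exists m; rewrite big_ord0 addr0.
  pose vk m w := v m w + \sum_(i < k) `|u i m w - x i w|.
  pose y w := penalized_limit (u k ^~ w) (vk ^~ w).
  have mvk m : measurable_fun setT (vk m).
    apply: measurable_funD => //; apply: measurable_sum => i.
    by apply: measurableT_comp => //; apply: measurable_funB.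
  exists (fun i => if i == k then y else x i).
    by move=> i; case: ifP => // _; exact: measurable_penalized_limit.
  move=> w v0 vlim [M pM] e e0.
  have vk_ge m : v m w <= vk m w by rewrite lerDl sumr_ge0.
  have [m hm] : exists m, vk m w + `|u k m w - y w| < e.
    apply: (@penalized_limitP (u k ^~ w) (vk ^~ w) M) => // [m|m|].
    - by rewrite (le_trans (u_le _ _ _))// (le_trans (pM m))// lerD2l.
    - exact: le_trans (vk_ge m).
    - by apply: xP => //; exists M.
  exists m; rewrite big_ord_recr/= eqxx addrA; under eq_bigr => i _ do
    rewrite (ltn_eqF (ltn_ord i)).
  exact: hm.
exists (fun w => \row_i x i w) => [i|w v0 vlim pM e /(xP w v0 vlim pM)[m hm]].
  by under eq_fun do rewrite mxE; exact: mx.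
exists m; apply: le_lt_trans hm; rewrite lerD2l (le_trans (enorm_le_l1 _))//.
by apply: ler_sum => i _; rewrite !mxE /u valK.
Qed.

End PenalizedLimit.

(** * Random vectors *)

Section RandomVectors.
Context d (T : measurableType d) (R : realType) (P : probability T R) (n : nat).
Local Notation L := (L0V P n).
Implicit Types (x y z : L) (G E F : set L).

Lemma measurable_ltr_set (f g : T -> R) : measurable_fun setT f ->
  measurable_fun setT g -> measurable [set w | f w < g w].
Proof.
move=> mf mg; rewrite -[X in measurable X]setTI.
exact: (measurable_fun_ltr mf mg measurableT (Y := [set true])).
Qed.

Lemma measurable_ler_set (f g : T -> R) : measurable_fun setT f ->
  measurable_fun setT g -> measurable [set w | f w <= g w].
Proof.
move=> mf mg; rewrite (_ : [set _ | _] = ~` [set w | g w < f w]).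
  by apply: measurableC; exact: measurable_ltr_set.
by apply/seteqP; split=> w /=; rewrite leNgt => /negP.
Qed.

Lemma measurable_enorm_dist (f g : T -> borel_rV R n) :
  measurable_fun setT f -> measurable_fun setT g ->
  measurable_fun setT (fun w => enorm ((f w : 'rV[R]_n) - g w)).
Proof.
move=> mf mg; apply: measurable_enorm; apply: measurable_fun_rV => i.
by under eq_fun do rewrite !mxE; apply: measurable_funB; exact: measurable_coord.
Qed.

Lemma L0V_eq x y : {ae P, forall w, x w = y w} -> x = y.
Proof.
move=> xy; rewrite -[x]reprK -[y]reprK; apply/eqmodP/asboolP.
by apply: filterS xy.
Qed.

(** The almost-everywhere filter of a probability is proper; this turns an almost sure contradiction
    into a contradiction. *)
Lemma ae_cst (Q : Prop) : {ae P, forall _, Q} -> Q.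
Proof.
have pP : ProperFilter (almost_everywhere P).
  apply: ae_properfilter_algebraOfSetsType.
  by rewrite [X in (_ < X)%E]probability_setT.
by move=> /filter_ex[].
Qed.

Lemma L0V_of_ae (M : set 'rV[R]_n) x : L0V_of P M x ->
  {ae P, forall w, M (x w)}.
Proof.
move=> [f fM ->].
have /eqmodP/asboolP : repr (\pi_(L) f) = f %[mod L] by rewrite reprK.
by apply: filterS => w fw; rewrite /L0V_fun fw.
Qed.

(** [L0V_of] asks for a representative with values in [M] everywhere; the given one is redefined as
    [m] where it leaves [M]. *)
Lemma ae_L0V_of (M : set 'rV[R]_n) m x : M m -> measurable [set w | M (x w)] ->
  {ae P, forall w, M (x w)} -> L0V_of P M x.
Proof.
move=> Mm mM aeM.
pose f w : borel_rV R n := if w \in [set w | M (x w)] then x w else m.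
have mf : measurable_fun setT f.
  apply: measurable_fun_ifT; last exact: measurable_cst.
    by apply: (measurable_fun_bool true); rewrite setTI preimage_mem_true.
  exact: L0V_measurable.
exists (mfun_Sub (mem_set mf)) => [w|].
  by rewrite /= /f; case: ifPn => // /set_mem.
apply: L0V_eq; apply: filterS2 aeM (L0V_classE P mf) => w Mw ->.
by rewrite /f mem_set.
Qed.

Lemma measurable_enorm_L0V x : measurable_fun setT (fun w => enorm (x w)).
Proof. exact: measurable_enorm (L0V_measurable x). Qed.

Lemma L0V_of_ballP x :
  L0V_of P (unit_ball R n) x <-> {ae P, forall w, enorm (x w) <= 1}.
Proof.
split; first exact: L0V_of_ae.
apply: (@ae_L0V_of _ 0); first by rewrite /unit_ball/= enorm0.
by apply: measurable_ler_set => //; exact: measurable_enorm_L0V.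
Qed.

Lemma within_continuousP E (f : L -> L) : {within E, continuous f} <->
  forall x, E x -> forall r : L0 P, L0_gt0 r -> exists2 s : L0 P, L0_gt0 s &
    forall y, E y -> rball x s y -> rball (f x) r (f y).
Proof.
rewrite subspace_continuousP; split=> fc x Ex.
  move=> r r0; have /(fc x Ex) : nbhs (f x) (rball (f x) r).
    by apply/nbhs_rballP; exists r.
  rewrite /fmap/= => /nbhs_rballP[s s0 sub]; exists s => // y Ey xy.
  exact: sub xy Ey.
move=> U /nbhs_rballP[r r0 rU]; have [s s0 sr] := fc x Ex r r0.
apply/nbhs_rballP; exists s => // y xy Ey; apply: rU; exact: sr.
Qed.

Lemma closed_rball_mem G x : closed G ->
  (forall r : L0 P, L0_gt0 r -> exists2 y, G y & rball x r y) -> G x.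
Proof.
move=> cG h; apply: cG => U /nbhs_rballP[r /h[y Gy xy] rU].
by exists y; split => //; exact: rU.
Qed.

Definition const_L0 (c : R) : L0 P := L0_class P (measurable_cst c).

Lemma const_L0E c : {ae P, forall w, const_L0 c w = c}.
Proof. exact: L0_classE. Qed.

Lemma const_L0_gt0 c : 0 < c -> L0_gt0 (const_L0 c).
Proof. by move=> c0; apply: filterS (const_L0E c) => w ->. Qed.

Lemma first_index (Q : nat -> Prop) : (exists k, Q k) ->
  exists2 k, Q k & forall i, (i < k)%N -> ~ Q i.
Proof.
move=> [k Qk]; have ex : exists k, `[< Q k >] by exists k; apply/asboolP.
case: (ex_minnP ex) => m /asboolP Qm mmin; exists m => // i im Qi.
by have := mmin i (introT (asboolP _) Qi); rewrite leqNgt im.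
Qed.

(* The first piece absorbs the points covered by no [D k]. *)
Lemma glue_first G (f : L -> L) (x : nat -> L) (D : nat -> set T) :
  sigma_stable G -> sigma_stable_map G f -> (forall k, G (x k)) ->
  (forall k, measurable (D k)) ->
  exists2 z, G z & {ae P, forall w, (exists k, D k w) ->
    exists k, [/\ D k w, forall i, (i < k)%N -> ~ D i w,
      z w = x k w & f z w = f (x k) w]}.
Proof.
move=> sG sf Gx mD.
pose D' k := if k is j.+1 then D j else ~` \bigcup_k D k.
have mD' k : measurable (D' k).
  by case: k => [|k] //=; apply: measurableC; apply: bigcup_measurable.
have covD : \bigcup_k seqDU D' k = setT.
  rewrite -seqDU_bigcup_eq; apply/seteqP; split=> // w _.
  have [[k _ Dk]|nD] := pselect ((\bigcup_k D k) w); first by exists k.+1.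
  by exists 0%N.
pose A := MPartition (seqDU_measurable mD') (trivIset_seqDU D') covD.
pose x' k := if k is j.+1 then x j else x 0%N.
have Gx' k : G (x' k) by case: k => [|k]; exact: Gx.
exists (Defs.glue A x'); first exact: sG.
rewrite (sf A x' Gx').
apply: filterS2 (L0V_classE P (measurable_glue A x'))
  (L0V_classE P (measurable_glue A (fun k => f (x' k)))) => w zw fzw.
move=> /first_index[k Dk kmin]; exists k.
have Akw : A k.+1 w.
  split=> //=; rewrite -bigcup_mkord => -[[|i] /= ik].
    by case; exists k.
  exact: kmin.
by split => //; rewrite ?zw ?fzw (glue_funE _ Akw).
Qed.

Lemma glue_first_id G (x : nat -> L) (D : nat -> set T) :
  sigma_stable G -> (forall k, G (x k)) -> (forall k, measurable (D k)) ->
  exists2 z, G z & {ae P, forall w, (exists k, D k w) ->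
    exists2 k, D k w & z w = x k w}.
Proof.
move=> sG Gx mD; have [|z Gz hz] := @glue_first G id x D sG _ Gx mD.
  by move=> A y Gy.
exists z => //; apply: filterS hz => w + /[dup] Dw => /(_ Dw)[k [Dk _ zk _]].
by exists k.
Qed.

(** The index [m] may depend on [w]. For a random radius [r], gluing the [g m] along the events
    where [g m] is [r]-close to [x] gives a member of [G] in [rball x r]. *)
Lemma closed_ae_limit G (g : nat -> L) x : sigma_stable G -> closed G ->
  (forall m, G (g m)) ->
  {ae P, forall w, forall e, 0 < e -> exists m, enorm (x w - g m w) < e} -> G x.
Proof.
move=> sG cG Gg lim; apply: closed_rball_mem => // r r0.
have [|z Gz hz] := @glue_first_id G g
    (fun m => [set w | enorm (x w - g m w) < r w]) sG Gg.
  move=> m; apply: measurable_ltr_set; last exact: L0_measurable.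
  by apply: measurable_enorm_dist; exact: L0V_measurable.
exists z => //; apply: filterS3 r0 lim hz => w r0 /(_ _ r0) ex /(_ ex)[k xk zk].
by rewrite zk.
Qed.

(** The vector equal to [y] on the event [D] and to [x] elsewhere lies in [rball x s], and by
    sigma-stability its image agrees with [f y] on [D]. *)
Lemma sigma_stable_map_local G (f : L -> L) x y (r s : L0 P) :
  sigma_stable G -> sigma_stable_map G f -> G x -> G y -> L0_gt0 s ->
  (forall z, G z -> rball x s z -> rball (f x) r (f z)) ->
  {ae P, forall w, enorm (x w - y w) < s w -> enorm (f x w - f y w) < r w}.
Proof.
move=> sG sf Gx Gy s0 hf.
pose D := [set w | enorm (x w - y w) < s w].
have [|[|k]|z Gz hz] := @glue_first G f (fun k => if k is 0%N then y else x)
    (fun k => if k is 0%N then D else setT) sG sf.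
- by case.
- apply: measurable_ltr_set; last exact: L0_measurable.
  by apply: measurable_enorm_dist; exact: L0V_measurable.
- exact: measurableT.
have xz : rball x s z.
  apply: filterS2 s0 hz => w s0 [|[|k] [/= Dk kmin -> _]] //.
    by exists 1%N.
  by rewrite subrr enorm0.
apply: filterS2 (hf z Gz xz) hz => w fxz [|[|k] [/= Dk kmin _ <-]] //.
  by exists 1%N.
by move=> Dw; case: (kmin 0%N).
Qed.

End RandomVectors.

(** * Castaing representations *)

Section CastaingRepresentation.
Context d (T : measurableType d) (R : realType) (P : probability T R) (n : nat).
Local Notation L := (L0V P n).
Implicit Types (x y z : L) (G : set L).

Lemma ae_sub_measure (A B : set T) : measurable A -> measurable B ->
  {ae P, forall w, A w -> B w} -> (P A <= P B)%E.
Proof.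
move=> mA mB AB.
rewrite (measureDI P mA mB) [X in (X + _ <= _)%E](_ : _ = 0%E); last first.
  apply: measure_negligible; first exact: measurableD.
  by apply: negligibleS AB => w [Aw nBw] /(_ Aw).
by rewrite add0e le_measure ?inE//; exact: measurableI.
Qed.

(** Exhaustion: combining a sequence in [G] that maximises [P (D x)] yields a [z] attaining the
    supremum. If some [D y] exceeded [D z] by a non-null set, combining [y] with [z] would beat the
    supremum. *)
Lemma essential_maximum G (D : L -> set T) : G !=set0 ->
  (forall x, measurable (D x)) ->
  (forall x : nat -> L, (forall k, G (x k)) ->
     exists2 z, G z & {ae P, forall w, (exists k, D (x k) w) -> D z w}) ->
  exists2 z, G z & forall x, G x -> {ae P, forall w, D x w -> D z w}.
Proof.
move=> [x0 Gx0] mD Dsup; pose p x := fine (P (D x)).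
have pE x : P (D x) = (p x)%:E by rewrite fineK// fin_num_measure.
have p_le x z : {ae P, forall w, D x w -> D z w} -> p x <= p z.
  by move=> xz; rewrite -lee_fin -!pE; exact: ae_sub_measure.
have S_sup : has_sup (p @` G).
  split; first by exists (p x0), x0.
  by exists 1 => _ [x _ <-]; rewrite -lee_fin -pE probability_le1.
have [k|x xP] := @choice _ _ (fun k x => G x /\ sup (p @` G) - k.+1%:R^-1 < p x).
  have k0 : 0 < k.+1%:R^-1 :> R by rewrite invr_gt0.
  have [_ [x Gx <-] ?] := sup_adherent k0 S_sup.
  by exists x.
have [z Gz xz] := Dsup x (fun k => (xP k).1).
have pz : sup (p @` G) <= p z.
  apply/ler_addgt0Pr => e e0.
  have [k _ /(_ k (leqnn k)) ke] := near_infty_natSinv_lt (PosNum e0).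
  have := (xP k).2; have /p_le : {ae P, forall w, D (x k) w -> D z w}.
    by apply: filterS xz => w h Dx; apply: h; exists k.
  by move: ke => /=; move: (k.+1%:R^-1) => ? ? ? ?; lra.
exists z => // y Gy.
have [|z' Gz' yz'] := Dsup (fun k => if k is 0%N then y else z); first by case.
have mU : measurable (D z `|` D y) by exact: measurableU.
have : (P (D z `|` D y) <= P (D z))%E.
  apply: (@le_trans _ _ (P (D z'))).
    apply: ae_sub_measure => //.
    by apply: filterS yz' => w h [?|?]; apply: h; [exists 1%N|exists 0%N].
  rewrite !pE lee_fin (le_trans _ pz)//.
  by apply: ub_le_sup; [case: S_sup|exists z'].
rewrite (measureDI P mU (mD z)) setUK -leeBrDr ?subee ?fin_num_measure// => U0.
exists ((D z `|` D y) `\` D z); split; first exact: measurableD.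
  by apply/eqP; rewrite -measure_le0.
by move=> w /= /not_implyP[Dy nDz]; split => //; right.
Qed.

Lemma rat_dense (v : 'rV[R]_n) e : 0 < e ->
  exists p : 'rV[rat]_n, enorm (v - map_mx ratr p) < e.
Proof.
move=> e0; have h0 : 0 < e / n.+1%:R by rewrite divr_gt0.
have q_ex i : exists q : rat, `|v 0 i - ratr q| < e / n.+1%:R.
  have [q] := @rat_in_itvoo R (v 0 i - e / n.+1%:R) (v 0 i + e / n.+1%:R)
    ltac:(by rewrite ltrBlDr -addrA ltrDl addr_gt0).
  by rewrite in_itv/= => qP; exists q; rewrite distrC ltr_distl.
exists (\row_i sval (cid (q_ex i))); apply: enorm_lt_coord => // i.
by rewrite !mxE; case: cid => q /= vq; exact: ltW.
Qed.

(** For each rational [p] and each [k], take a member of [G] that is [k.+1%:R^-1]-close to [p] on an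
    essentially largest event. Wherever [x] is that close to [p], so is this member, and it is then
    within twice that distance of [x]. *)
Lemma castaing_representation G : G !=set0 -> sigma_stable G ->
  exists2 e : nat -> L, forall j, G (e j) &
  forall x, G x -> {ae P, forall w, forall r, 0 < r ->
    exists j, enorm (x w - e j w) < r}.
Proof.
move=> G0 sG; pose D (p : 'rV[rat]_n) (k : nat) x :=
  [set w | enorm (map_mx ratr p - x w) < k.+1%:R^-1].
have mD p k x : measurable (D p k x).
  apply: measurable_ltr_set => //; apply: measurable_enorm_dist.
    exact: measurable_cst.
  exact: L0V_measurable.
have max_ex (pk : 'rV[rat]_n * nat) : exists z, G z /\
    forall x, G x -> {ae P, forall w, D pk.1 pk.2 x w -> D pk.1 pk.2 z w}.
  have [|z Gz zmax] := @essential_maximum G (D pk.1 pk.2) G0 (mD _ _).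
    move=> x Gx; have [z Gz hz] := @glue_first_id _ _ _ P _ G x
      (fun k => D pk.1 pk.2 (x k)) sG Gx (fun k => mD _ _ _).
    by exists z => //; apply: filterS hz => w h /h[k + zk]; rewrite /D/= zk.
  by exists z.
have [E EP] := choice max_ex; have [x0 Gx0] := G0.
exists (fun j => if unpickle j is Some pk then E pk else x0) => [j|x Gx].
  by case: unpickle => [pk|//]; have [] := EP pk.
have : {ae P, forall w, forall j, if unpickle j is Some pk then
    D pk.1 pk.2 x w -> D pk.1 pk.2 (E pk) w else True}.
  apply: ae_foralln => j; case: unpickle => [pk|]; last exact: aeW.
  by have [_] := EP pk; apply.
apply: filterS => w hw r r0.
have r2 : 0 < r / 2 by rewrite divr_gt0.
have [k _ /(_ k (leqnn k)) /= kr] := near_infty_natSinv_lt (PosNum r2).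
have [p xp] := @rat_dense (x w) k.+1%:R^-1 ltac:(by rewrite invr_gt0).
have := hw (pickle (p, k)); rewrite pickleK /= => /(_ _) h.
exists (pickle (p, k)); rewrite pickleK.
apply: le_lt_trans (enorm_triangle _ (map_mx ratr p) _) _.
rewrite [r]splitr ltrD// (lt_trans _ kr)//; apply: h.
by rewrite /D/= enorm_distC.
Qed.

End CastaingRepresentation.

(** * Random fixed points *)

Section BucMap.
Context (R : realType) (n : nat).

Lemma buc_map_uniform (g : 'rV[R]_n -> 'rV[R]_n) : buc_map g ->
  forall e, 0 < e -> exists2 r, 0 < r &
    forall x y, enorm (x - y) < r -> enorm (g x - g y) < e.
Proof.
move=> bg e e0; have h0 : 0 < e / n.+1%:R by rewrite divr_gt0.
have [i|r rP] := @choice _ _ (fun i r => 0 < r /\ forall x y,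
    enorm (x - y) < r -> `|g x 0 i - g y 0 i| < e / n.+1%:R).
  by have [_ /(_ _ h0)[r r0 hr]] := bg i; exists r.
exists (\big[Num.min/1]_(i < n) r i).
  by apply: lt_bigmin => // i _; have [] := rP i.
move=> x y xy; apply: enorm_lt_coord => // i.
rewrite !mxE; apply: ltW; apply: (rP i).2.
by apply: lt_le_trans xy _; exact: bigmin_le_cond.
Qed.

End BucMap.

Section RandomFixedPoint.
Context d (T : measurableType d) (R : realType) (P : probability T R) (n : nat).
Local Notation L := (L0V P n).
Implicit Types (x : L) (G : set L).

(** The weights are left unnormalised because partial sums may vanish during the induction. The new
    coefficient is the ratio of consecutive partial sums, which is 0 where its denominator vanishes;
    both sides are then 0. *)
Lemma L0_convex_sum G (g : nat -> L) (t : nat -> T -> R) N : L0_convex G ->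
  (forall j, G (g j)) -> (forall j w, 0 <= t j w) ->
  (forall j, (j <= N)%N -> measurable_fun setT (t j)) ->
  exists2 c, G c & {ae P, forall w,
    (\sum_(j < N.+1) t j w) *: c w = \sum_(j < N.+1) t j w *: g j w}.
Proof.
move=> cvx Gg t0; elim: N => [|N IH] mt.
  by exists (g 0%N) => //; apply: aeW => w; rewrite !big_ord1.
have [c Gc cE] := IH (fun j jN => mt j (leqW jN)).
pose s k w := \sum_(j < k) t j w.
have s0 k w : 0 <= s k w by rewrite sumr_ge0.
have sS w : s N.+2 w = s N.+1 w + t N.+1 w by rewrite /s big_ord_recr.
have ml : measurable_fun setT (fun w => s N.+1 w * (s N.+2 w)^-1).
  have ms k : (k <= N.+2)%N -> measurable_fun setT (s k).
    move=> kN; apply: measurable_sum => j; apply: mt.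
    by rewrite -ltnS (leq_trans (ltn_ord j)).
  apply: measurable_funM; first exact: ms.
  under eq_fun do rewrite -powR_inv1 ?s0//.
  by apply: (measurableT_comp (@measurable_powR R (-1))); apply: ms.
have lE := L0_classE P ml.
exists (L0V_conv (L0_class P ml) c (g N.+1)).
  apply: cvx => //; apply: filterS lE => w ->.
    by rewrite mulr_ge0// invr_ge0.
  have [->|s1] := eqVneq (s N.+2 w) 0; first by rewrite invr0 mulr0.
  by rewrite ler_pdivrMr ?lt_def ?s1//= mul1r sS lerDl.
apply: filterS3 cE lE
  (L0V_classE P (measurable_L0V_conv (L0_class P ml) c (g N.+1))).
move=> w cE lw; rewrite /L0V_conv => ->; rewrite lw.
rewrite -/(s N.+2 w) big_ord_recr/= -cE -/(s N.+1 w).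
rewrite scalerDr !scalerA.
have [sz|sn] := eqVneq (s N.+2 w) 0.
  have := s0 N.+1 w; have := t0 N.+1 w; have := sS w; rewrite sz => a b c0.
  have -> : s N.+1 w = 0 by lra.
  have -> : t N.+1 w = 0 by lra.
  by rewrite !mul0r !scale0r.
congr (_ *: _ + _ *: _); first by field.
by rewrite mulrBr mulr1 mulrCA divff// mulr1 sS addrAC subrr add0r.
Qed.

Lemma measurable_weight (e : nat -> L) N j (y : 'rV[R]_n) :
  measurable_fun setT (fun w => weight (fun i => e i w) N j y).
Proof.
have me i : measurable_fun setT (fun w => enorm (y - e i w)).
  apply: measurable_enorm_dist; first exact: measurable_cst.
  exact: L0V_measurable.
apply: measurable_maxr; first exact: measurable_cst.
apply: measurable_funB => //; apply: measurable_funD => //.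
by elim: N => [|N IH] //=; exact: measurable_minr.
Qed.

Lemma interpolate_in_convex G (e g : nat -> L) N y : L0_convex G ->
  (forall j, G (g j)) -> exists2 c, G c &
  {ae P, forall w, c w = interpolate (fun j => e j w) (fun j => g j w) N y}.
Proof.
move=> cvx Gg.
have [j w|j _|c Gc cE] := @L0_convex_sum G g
    (fun j w => weight (fun i => e i w) N j y) N cvx Gg.
- exact: weight_ge0.
- exact: measurable_weight.
exists c => //; apply: filterS cE => w cE.
rewrite /interpolate -cE scalerA mulVf ?scale1r//.
by rewrite gt_eqF// total_weight_gt0.
Qed.

(** Rational points are countable, so a single deterministic enumeration of candidates serves every
    [w]. One third of [r] goes to the approximate fixed point, one to moving it to [p], one to the
    resulting change of the interpolation. *)
Lemma interpolate_rat_fixed (e g : nat -> 'rV[R]_n) N (M r : R) :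
  ~ (exists r : 'rV[R]_n -> 'rV[R]_n, sphere_retraction r) -> 0 < M ->
  (forall j, enorm (g j) <= M) -> 0 < r ->
  exists p : 'rV[rat]_n,
    enorm (interpolate e g N (map_mx ratr p) - map_mx ratr p) < r.
Proof.
move=> nr M0 gM r0; pose F := interpolate e g N.
have FM y : enorm (F y) <= M.
  by rewrite -[F y]subr0; apply: interpolate_dist => j _ _; rewrite subr0.
have r3 : 0 < r / 3 by rewrite divr_gt0.
have bF : buc_map F by exact: buc_interpolate.
have [y Fy] := approx_fixed_point nr M0 bF FM r3.
have [s s0 Fs] := buc_map_uniform bF r3.
have [p yp] := @rat_dense R n y (Num.min s (r / 3)) ltac:(by rewrite lt_min s0).
move: yp; rewrite lt_min => /andP[/Fs yp1 yp2]; exists p; rewrite -/F.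
apply: le_lt_trans (enorm_triangle _ (F y) _) _; rewrite enorm_distC.
have := enorm_triangle (F y) y (map_mx ratr p); lra.
Qed.

Theorem random_fixed_point G (f : L -> L) :
  ~ (exists r : 'rV[R]_n -> 'rV[R]_n, sphere_retraction r) ->
  G !=set0 -> sigma_stable G -> as_bounded G -> closed G -> L0_convex G ->
  Tc_stable_map G G f -> exists2 x, G x & f x = x.
Proof.
move=> nr G0 sG [xi [xi0 Gxi _]] cG cvx [fG sf fc].
have [e Ge dense_e] := castaing_representation G0 sG.
have Gfe j : G (f (e j)) by exact: fG.
(* [dec] enumerates all pairs of an interpolation level and a rational candidate; integers that code
   no pair get a harmless default. *)
pose dec m : nat * 'rV[rat]_n := odflt (0%N, 0) (unpickle m).
pose p m : 'rV[R]_n := map_mx ratr (dec m).2.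
pose F w N y := interpolate (fun j => e j w) (fun j => f (e j) w) N y.
have [m|c cP] := @choice _ _ (fun m c => G c /\
    {ae P, forall w, c w = F w (dec m).1 (p m)}).
  by have [c Gc cE] := interpolate_in_convex e (dec m).1 (p m) cvx Gfe; exists c.
(* A small [v m w] means both that [p m] is nearly fixed by the interpolation at [w] and that its
   level is high. *)
pose v m w := enorm (c m w - p m) + (dec m).1.+1%:R^-1.
have [x mx xP] : exists2 x : T -> 'rV[R]_n,
    forall i, measurable_fun setT (fun w => x w 0 i) & forall w,
    (forall m, 0 <= v m w) -> (forall r, 0 < r -> exists m, v m w < r) ->
    (exists M, forall m, enorm (p m) <= M + v m w) ->
    forall r, 0 < r -> exists m, v m w + enorm (p m - x w) < r.
  apply: (@measurable_cluster_point _ _ _ _ (fun m _ => p m) v) => // m.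
  apply: measurable_funD => //; apply: measurable_enorm_dist.
    exact: L0V_measurable.
  exact: measurable_cst.
pose X := L0V_class P (measurable_fun_rV mx).
have XE : {ae P, forall w, X w = x w} := L0V_classE P (measurable_fun_rV mx).
have fe_xi : {ae P, forall w, forall j, enorm (f (e j) w) <= xi w}.
  by apply: ae_foralln => j; exact: Gxi.
have cE : {ae P, forall w, forall m, c m w = F w (dec m).1 (p m)}.
  by apply: ae_foralln => m; have [] := cP m.
have cluster : {ae P, forall w, forall r, 0 < r ->
    exists m, v m w + enorm (p m - X w) < r}.
  apply: filterS2 XE (filterI xi0 (filterI fe_xi cE)) => w -> [xw [few cw]].
  apply: xP => [m|r r0|].
  - by rewrite addr_ge0 ?enorm_ge0// invr_ge0.
  - have r2 : 0 < r / 2 by rewrite divr_gt0.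
    have [N _ /(_ N (leqnn N)) Nr] := near_infty_natSinv_lt (PosNum r2).
    (* [xi w] may be 0, while the approximate fixed point result needs a positive bound. *)
    have few1 j : enorm (f (e j) w) <= xi w + 1.
      by rewrite (le_trans (few j))// lerDl.
    have [|q qr] := interpolate_rat_fixed (e ^~ w) N nr _ few1 r2.
      by rewrite ltr_wpDl.
    exists (pickle (N, q)).
    by rewrite /v cw /p /dec pickleK /= [r]splitr ltrD.
  - exists (xi w) => m.
    have : enorm (c m w) <= xi w.
      rewrite cw -[F _ _ _]subr0; apply: interpolate_dist => j _ _.
      by rewrite subr0.
    have := enorm_triangle (p m) (c m w) 0; rewrite !subr0 /v enorm_distC.
    have : 0 <= (dec m).1.+1%:R^-1 :> R by rewrite invr_ge0.
    by move: (_^-1) => ? ? ? ?; lra.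
have GX : G X.
  apply: (closed_ae_limit sG cG (fun m => (cP m).1)).
  apply: filterS cluster => w h r /h[m hm]; exists m.
  apply: le_lt_trans (enorm_triangle _ (p m) _) _; rewrite addrC.
  rewrite enorm_distC [X in _ + X]enorm_distC; apply: le_lt_trans hm.
  by rewrite lerD2r lerDl invr_ge0.
move/within_continuousP: fc => /(_ X GX) fc.
have inv0 k : 0 < k.+1%:R^-1 :> R by rewrite invr_gt0.
(* Continuity at [X] is used only at the precisions [k.+1%:R^-1], so countably many null sets are
   discarded. *)
have [k|s sP] := @choice _ _ (fun k s => L0_gt0 s /\ forall y, G y ->
    rball X s y -> rball (f X) (const_L0 P k.+1%:R^-1) (f y)).
  by have [s s0 hs] := fc _ (const_L0_gt0 P (inv0 k)); exists s.
have s0 : {ae P, forall w, forall k, 0 < s k w}.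
  by apply: ae_foralln => k; have [] := sP k.
have fX_near : {ae P, forall w, forall k j,
    enorm (X w - e j w) < s k w -> enorm (f X w - f (e j) w) < k.+1%:R^-1}.
  apply: ae_foralln => k; apply: ae_foralln => j; have [sk0 hk] := sP k.
  apply: filterS2 (const_L0E P k.+1%:R^-1)
    (sigma_stable_map_local sG sf GX (Ge j) sk0 hk) => w ->; exact.
exists X => //; apply: L0V_eq.
apply: filterS2 (filterI cluster (dense_e X GX)) (filterI cE (filterI s0 fX_near)).
move=> w [clw dw] [cw [s0w nearw]]; apply/eqP; rewrite -subr_eq0; apply/eqP.
apply: enorm_eq0; apply/eqP; rewrite eq_le enorm_ge0 andbT.
apply/ler_addgt0Pr => r r0; rewrite add0r.
have r2 : 0 < r / 2 by rewrite divr_gt0.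
have [k _ /(_ k (leqnn k)) /= kr] := near_infty_natSinv_lt (PosNum r2).
(* A node [e j] of positive weight at [p m] turns out to be within [3 * h < s k w] of [X w]. The
   final estimate is [k.+1%:R^-1 + h < r / 2 + r / 4]. *)
pose h := Num.min (s k w / 4) (r / 4).
have h0 : 0 < h by rewrite lt_min !divr_gt0.
have [hs hr] : h <= s k w / 4 /\ h <= r / 4 by rewrite !ge_min !lexx orbT.
have [i ei] := dw h h0.
(* The second bound forces the level [N] to be at least [i], so that [e i], which is close to [X w],
   is among the nodes. *)
have [m] := clw (Num.min h i.+1%:R^-1) ltac:(by rewrite lt_min h0 inv0).
rewrite /v lt_min cw; set N := (dec m).1 => /andP[hm im].
have N0 := inv0 N; have pX0 := enorm_ge0 (p m - X w).
have Fp0 := enorm_ge0 (F w N (p m) - p m).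
have iN : (i <= N)%N.
  have : N.+1%:R^-1 < i.+1%:R^-1 :> R.
    by move: im; move: (i.+1%:R^-1) (N.+1%:R^-1) N0 => ? ? ? ?; lra.
  by rewrite ltf_pV2 ?posrE ?ltr0n// ltr_nat ltnS => /ltnW.
have FfX : enorm (F w N (p m) - f X w) <= k.+1%:R^-1.
  apply: interpolate_dist => j jN pj.
  rewrite enorm_distC; apply/ltW/nearw.
  have := mindist_le (e ^~ w) (p m) iN.
  have := enorm_triangle (p m) (X w) (e i w).
  have := enorm_triangle (X w) (p m) (e j w).
  rewrite (enorm_distC (X w) (p m)).
  by move: pj hm N0; move: (N.+1%:R^-1) => ? ? ? ? ? ? ?; lra.
have := enorm_triangle (f X w) (F w N (p m)) (X w).
have := enorm_triangle (F w N (p m)) (p m) (X w).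
rewrite (enorm_distC (f X w) (F _ _ _)).
move: FfX kr hm N0; move: (N.+1%:R^-1) (k.+1%:R^-1) => ? ? ? ? ? ? ? ?; lra.
Qed.

End RandomFixedPoint.

(** * The random ball and sphere *)

Section Lift.
Context d (T : measurableType d) (R : realType) (P : probability T R) (n : nat).
Local Notation L := (L0V P n).

Lemma buc_continuous (h : 'rV[R]_n -> R) : buc h -> continuous h.
Proof.
move=> [_ hu] v U /nbhs_ballP[e /= /hu[r r0 hr] eU].
apply/nbhs_ballP; exists (r / n.+1%:R); first by rewrite /= divr_gt0.
move=> y [_ vy] /=; apply: eU; apply: hr; apply: enorm_lt_coord => // i.
by rewrite !mxE; exact: ltW (vy 0 i).
Qed.

Lemma measurable_buc_comp (h : 'rV[R]_n -> R) (x : T -> borel_rV R n) :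
  buc h -> measurable_fun setT x -> measurable_fun setT (fun w => h (x w)).
Proof.
move=> bh mx; apply: (measurability _ (RGenOpens.measurableE R)).
move=> _ [_ [a [b ->]] <-].
apply: (mx measurableT (h @^-1` `]a, b[%classic)); apply: sub_sigma_algebra.
by apply: open_comp (interval_open _ _) => // v _; exact: buc_continuous.
Qed.

(* [s] is the supremum of the moduli available at precisions below [e]. *)
Lemma measurable_modulus (r : nat -> R) (e : L0 P) : (forall k, 0 < r k) ->
  L0_gt0 e -> exists2 s : L0 P, L0_gt0 s &
  (* Strictness of [a < s w] yields one available modulus above [a], so the supremum need not be
     attained. *)
  {ae P, forall w a, a < s w -> 0 <= a ->
    exists2 k, k.+1%:R^-1 < e w & a < r k}.
Proof.
move=> r0 e0; pose u k w := if k.+1%:R^-1 < e w then Num.min (r k) 1 else 0.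
have u_le1 k w : u k w <= 1.
  by rewrite /u; case: ifP => // _; rewrite ge_min lexx orbT.
have ub w : has_ubound (range (u ^~ w)) by exists 1 => _ [k _ <-].
have ms : measurable_fun setT (fun w => sups (u ^~ w) 0%N).
  apply: measurable_fun_sups => // k; rewrite /u.
  apply: measurable_fun_ifT; [|exact: measurable_cst|exact: measurable_cst].
  by apply: measurable_fun_ltr => //; exact: L0_measurable.
exists (L0_class P ms).
  apply: filterS2 e0 (L0_classE P ms) => w e0 ->.
  have [k _ /(_ k (leqnn k)) /= ke] := near_infty_natSinv_lt (PosNum e0).
  apply: (@lt_le_trans _ _ (u k w)); first by rewrite /u ke lt_min r0 ltr01.
  by apply: ub_le_sup; [exact: has_ubound_sdrop|exists k].
apply: filterS (L0_classE P ms) => w -> a sa a0; apply: contrapT => nk.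
suff : sups (u ^~ w) 0%N <= a by rewrite leNgt sa.
apply: ge_sup; first by exists (u 0%N w), 0%N.
move=> _ [k _ <-]; rewrite /u; case: ifPn => // ke.
rewrite ge_min leNgt; case: (ltP a (r k)) => //= ar.
by case: nk; exists k.
Qed.

Lemma L0V_piE (f : {mfun T >-> borel_rV R n}) :
  {ae P, forall w, (\pi_L f : L) w = f w}.
Proof.
have /eqmodP/asboolP : repr (\pi_L f) = f %[mod L] by rewrite reprK.
by apply: filterS => w; exact.
Qed.

(** The moduli of [phi] do not depend on [w], so [measurable_modulus] converts a random precision
    into a random radius. Sigma-stability holds because the lift acts pointwise. *)
Lemma buc_lift (phi : 'rV[R]_n -> 'rV[R]_n) : buc_map phi ->
  exists F : L -> L, [/\ forall x, {ae P, forall w, F x w = phi (x w)},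
    forall E, sigma_stable_map E F,
    forall E, {within E, continuous F} &
    forall M N : set 'rV[R]_n, (forall v, M v -> N (phi v)) ->
      set_fun (L0V_of P M) (L0V_of P N) F].
Proof.
move=> bphi.
have mphi (x : T -> borel_rV R n) : measurable_fun setT x ->
    measurable_fun setT (fun w => phi (x w) : borel_rV R n).
  move=> mx; apply: measurable_fun_rV => i.
  exact: (measurable_buc_comp (bphi i) mx).
pose F (x : L) : L := L0V_class P (mphi _ (L0V_measurable x)).
have FE x : {ae P, forall w, F x w = phi (x w)} := L0V_classE P _.
exists F; split => //.
- move=> E A x _; apply: L0V_eq.
  have FxE : {ae P, forall w, forall k, F (x k) w = phi (x k w)}.
    by apply: ae_foralln => k; exact: FE.
  apply: filterS3 (FE (Defs.glue A x)) FxE (filterI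
    (L0V_classE P (measurable_glue A x))
    (L0V_classE P (measurable_glue A (fun k => F (x k))))).
  move=> w -> Fx [-> ->].
  have [k _ Ak] : (\bigcup_k A k) w by rewrite block_cover.
  by rewrite !(glue_funE _ Ak) Fx.
- move=> E; apply/within_continuousP => x Ex e e0.
  have [k|r rP] := @choice _ _ (fun k r => 0 < r /\ forall u v,
      enorm (u - v) < r -> enorm (phi u - phi v) < k.+1%:R^-1).
    have [|r r0 hr] := buc_map_uniform bphi (e := k.+1%:R^-1).
      by rewrite invr_gt0.
    by exists r.
  have [s s0 hs] := measurable_modulus (fun k => (rP k).1) e0.
  exists s => // y _ xy.
  apply: filterS3 (filterI (FE x) (FE y)) hs xy => w [-> ->] + xys.
  move=> /(_ _ xys (enorm_ge0 _))[k ke xyr].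
  by apply: lt_trans ke; apply: (rP k).2.
- move=> M N MN x [f fM ->].
  have mf : measurable_fun setT (fun w => phi (f w) : borel_rV R n).
    exact: (mphi _ (measurable_funPT f)).
  exists (mfun_Sub (mem_set mf)) => [w|]; first exact: MN.
  apply: L0V_eq; apply: filterS3 (FE (\pi_L f)) (L0V_classE P mf) (L0V_piE f).
  by move=> w -> -> ->.
Qed.

End Lift.

Section BallAndSphere.
Context d (T : measurableType d) (R : realType) (P : probability T R) (n : nat).
Local Notation L := (L0V P n).
Let LB : set L := L0V_of P (unit_ball R n).
Let LS : set L := L0V_of P (unit_sphere R n).

Lemma Tc_stable_map_id : Tc_stable_map LS LB id.
Proof.
split=> //.
  by move=> x [f f1 ->]; exists f => // w; rewrite /unit_ball/= f1.
by apply/within_continuousP => x _ r r0; exists r.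
Qed.

Lemma sphere_retraction_r_image (r : 'rV[R]_n -> 'rV[R]_n) :
  sphere_retraction r -> Tc_r_image LS LB.
Proof.
move=> [br r1 rid]; have [F [FE Fs Fc Fset]] := buc_lift P br.
exists F, id; split; first by split => //; apply: Fset => v _; exact: r1.
  exact: Tc_stable_map_id.
move=> x /L0V_of_ae x1; apply: L0V_eq.
by apply: filterS2 x1 (FE x) => w x1 ->; exact: rid.
Qed.

(* A fixed point of [g \o - \o h] would give [h x = - h x]. *)
Lemma fixed_point_not_r_image :
  (forall f : L -> L, Tc_stable_map LB LB f -> exists2 x, LB x & f x = x) ->
  ~ Tc_r_image LS LB.
Proof.
move=> fp [h [g [[hset hs hc] [gset gs gc] hg]]].
(* [radial] makes the antipodal map bounded without changing it on the sphere. *)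
have bneg : buc_map (fun v : 'rV[R]_n => - radial v).
  move=> i; under eq_fun do rewrite mxE.
  exact/bucN/buc_radial.
have [F [FE Fs Fc Fset]] := buc_lift P bneg.
have Fsph : set_fun LS LS F.
  by apply: Fset => v v1; rewrite /unit_sphere/= enormN radial_id v1.
have [|x Bx fx] := fp (g \o F \o h).
  split.
  - by move=> x /hset /Fsph /gset.
  - move=> A x Bx /=; rewrite hs// (Fs LS) => [|k]; last exact: hset.
    by rewrite gs// => k; apply/Fsph/hset.
  - apply/within_continuousP => x Bx r r0.
    move/within_continuousP: gc => /(_ (F (h x)) (Fsph _ (hset _ Bx)) r r0).
    move=> [s s0 gs'].
    move/within_continuousP: (Fc LS) => /(_ (h x) (hset _ Bx) s s0)[t t0 Ft].
    move/within_continuousP: hc => /(_ x Bx t t0)[q q0 hq].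
    exists q => // y By xy; apply: gs'; first exact/Fsph/hset.
    by apply: Ft; [exact: hset|exact: hq].
have Shx := hset _ Bx.
have hE : h x = F (h x) by rewrite -[LHS]/(h x) -{1}fx /= hg//; exact: Fsph.
apply: (@ae_cst _ _ _ P); apply: filterS2 (L0V_of_ae Shx) (FE (h x)) => w.
rewrite -hE /unit_sphere/= => h1; rewrite radial_id ?h1// => hN.
have : enorm (h x w + h x w) = 0 by rewrite {2}hN subrr enorm0.
rewrite -mulr2n -scaler_nat enormZ h1 mulr1 normr_nat => /eqP.
by rewrite pnatr_eq0.
Qed.

Lemma random_ball_sigma_stable : sigma_stable LB.
Proof.
move=> A x Bx; apply/L0V_of_ballP.
have : {ae P, forall w, forall k, enorm (x k w) <= 1}.
  by apply: ae_foralln => k; apply/L0V_of_ballP; exact: Bx.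
apply: filterS2 (L0V_classE P (measurable_glue A x)) => w -> x1.
have [k _ Ak] : (\bigcup_k A k) w by rewrite block_cover.
by rewrite (glue_funE _ Ak).
Qed.

Lemma random_ball_closed : closed LB.
Proof.
move=> x clx; apply/L0V_of_ballP.
have : {ae P, forall w, forall k : nat, enorm ((x : L) w) <= 1 + k.+1%:R^-1}.
  apply: ae_foralln => k.
  have k0 : 0 < k.+1%:R^-1 :> R by rewrite invr_gt0.
  have [|y [/L0V_of_ballP y1 xy]] := clx (rball x (const_L0 P k.+1%:R^-1)).
    apply/nbhs_rballP; exists (const_L0 P k.+1%:R^-1) => //.
    exact: const_L0_gt0.
  apply: filterS3 y1 xy (const_L0E P k.+1%:R^-1) => w y1 + kE; rewrite kE => xy.
  rewrite -[(x : L) w](subrK ((y : L) w)) addrC (le_trans (enormD _ _))//.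
  by rewrite lerD// ltW.
apply: filterS => w h; apply/ler_addgt0Pr => e e0.
have [k _ /(_ k (leqnn k)) /= ke] := near_infty_natSinv_lt (PosNum e0).
by rewrite (le_trans (h k))// lerD2l ltW.
Qed.

Lemma random_ball_convex : L0_convex LB.
Proof.
move=> x y l /L0V_of_ballP x1 /L0V_of_ballP y1 l0 l1; apply/L0V_of_ballP.
apply: filterS3 (filterI x1 y1) (filterI l0 l1)
  (L0V_classE P (measurable_L0V_conv l x y)) => w [xw yw] [lw0 lw1].
rewrite /L0V_conv => ->; rewrite (le_trans (enormD _ _))// !enormZ.
have l1' : 0 <= 1 - l w by rewrite subr_ge0.
rewrite !ger0_norm//; have := enorm_ge0 (x w); have := enorm_ge0 (y w); nra.
Qed.

(* Boundedness requires the essential supremum of the norms to be exhibited; it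
   is the constant [1] because [n] is positive. *)
Lemma random_ball_bounded : (0 < n)%N -> as_bounded LB.
Proof.
move=> n0; exists (const_L0 P 1); split.
- by apply: filterS (const_L0E P 1) => w ->.
- move=> x /L0V_of_ballP; apply: filterS2 (const_L0E P 1) => w ->; exact.
- pose u : borel_rV R n := (delta_mx 0 (Ordinal n0) : 'rV[R]_n).
  have u1 : enorm (u : 'rV[R]_n) = 1.
    rewrite /enorm (bigD1 (Ordinal n0))//= big1 => [|i i0].
      by rewrite mxE !eqxx expr1n addr0 sqrtr1.
    by rewrite mxE eqxx /= (negbTE i0) expr0n.
  have uE := L0V_classE P (measurable_cst u : measurable_fun setT (cst u)).
  have Bu : LB (L0V_class P (measurable_cst u)).
    by apply/L0V_of_ballP; apply: filterS uE => w ->; rewrite u1.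
  move=> eta /(_ _ Bu) h; apply: filterS3 uE (const_L0E P 1) h => w uw ->.
  by rewrite uw u1.
Qed.

End BallAndSphere.

Theorem theorem6p6 (disp : measure_display) (Omega : measurableType disp)
    (R : realType) (P : probability Omega R) (d : nat) (d_gt0 : (0 < d)%N) :
  let LB := L0V_of P (unit_ball R d) in
  let LS := L0V_of P (unit_sphere R d) in
  let A := ~ Tc_r_image LS LB /\ ~ Tc_retract LS LB in
  let B := forall f : L0V P d -> L0V P d, Tc_stable_map LB LB f ->
    exists2 x, LB x & f x = x in
  let C := forall G : set (L0V P d),
    G !=set0 -> sigma_stable G -> as_bounded G -> closed G -> L0_convex G ->
    forall f : L0V P d -> L0V P d, Tc_stable_map G G f ->
    exists2 x, G x & f x = x in
  (A <-> B) /\ (B <-> C).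
Proof.
move=> LB LS A B C.
have AC : A -> C.
  move=> [nimage _] G G0 sG bG cG cvx f hf.
  apply: (random_fixed_point _ G0 sG bG cG cvx hf) => -[r hr].
  by apply: nimage; exact: sphere_retraction_r_image hr.
have CB : C -> B.
  move=> c f hf; apply: c hf.
  - have m0 : measurable_fun setT (cst 0 : Omega -> borel_rV R d) by [].
    exists (L0V_class P m0); apply/L0V_of_ballP.
    by apply: filterS (L0V_classE P m0) => w ->; rewrite enorm0.
  - exact: random_ball_sigma_stable.
  - exact: random_ball_bounded.
  - exact: random_ball_closed.
  - exact: random_ball_convex.
(* A retract is an r-image with [g = id], so the second half of (A) follows from the first. *)
have BA : B -> A.
  move=> /fixed_point_not_r_image nimage; split => // -[_ [h [hh hid hx]]].
  by apply: nimage; exists h, id.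
by split; split; [move=> /AC/CB|exact: BA|move=> /BA/AC|exact: CB].
Qed.
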